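(* For every fixed constant positive integer $c$, there is a polynomial time algorithm which, given a tree $T$, decides whether $wr(T)\le c$.
   Context: All graphs are finite, simple and undirected. For a set $E'$ of edges of a graph, the subgraph induced by $E'$ is the graph whose edge set is $E'$ and whose vertex set is the set of endpoints of edges in $E'$. A graph is weakly semiregular if there are two numbers $a,b$ (not necessarily distinct) such that the degree of every vertex is $a$ or $b$. The weakly semiregular number $wr(G)$ of a graph $G$ is the minimum number of subsets into which $E(G)$ can be partitioned so that the subgraph induced by each subset is weakly semiregular. *)

(* Defs.v *)
From HB Require Import structures.
From mathcomp Require Import all_boot.
From mathcomp Require Import boolp.
Set Implicit Arguments. Unset Strict Implicit. Unset Printing Implicit Defensive.

Definition simple_graph n (e : rel 'I_n) : Prop :=
  (forall x y, e x y = e y x) /\ (forall x, e x x = false).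

Definition edges n (e : rel 'I_n) : {set {set 'I_n}} :=
  [set [set x; y] | x in 'I_n, y in 'I_n & e x y].

Definition is_tree n (e : rel 'I_n) : Prop :=
  [/\ simple_graph e, 0 < n,
      (forall x y, connect e x y) & #|edges e| = n.-1].

Definition degF n (F : {set {set 'I_n}}) (v : 'I_n) : nat :=
  #|[set f in F | v \in f]|.

(* The subgraph induced by F (vertex set = endpoints of edges of F, i.e. the
   vertices of positive degree) is weakly semiregular: all degrees lie in {a,b}. *)
Definition weakly_semiregular n (F : {set {set 'I_n}}) : Prop :=
  exists a b : nat, forall v, 0 < degF F v -> degF F v = a \/ degF F v = b.

Definition wsr_partition n (e : rel 'I_n) (P : {set {set {set 'I_n}}}) : Prop :=
  partition P (edges e) /\ (forall F, F \in P -> weakly_semiregular F).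

(* wr(G): minimum number of blocks of a partition of E(G) into edge sets
   inducing weakly semiregular subgraphs.  (The partition into singletons is
   always such a partition, with #|E(G)| blocks, so the default #|E(G)| of the
   iterated minimum does not affect the value.) *)
Definition wr n (e : rel 'I_n) : nat :=
  \big[minn/#|edges e|]_(P : {set {set {set 'I_n}}} |
       `[< wsr_partition e P >]) #|P|.

Inductive sym := S0 | S1 | Blank.
Inductive move := MoveL | MoveR | Stay.

(* A deterministic single-tape Turing machine, tape infinite in both
   directions; it halts when delta returns None, and accepts iff the halting
   state is accepting. *)
Record TM := {
  state : finType;
  start : state;
  delta : state -> sym -> option (state * sym * move);
  accepting : pred state }.

(* configuration: state, left part of tape (reversed, nearest first),
   scanned symbol, right part of tape *)
Definition config (M : TM) := (state M * seq sym * sym * seq sym)%type.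

Definition step (M : TM) (c : config M) : option (config M) :=
  let: (q, l, h, r) := c in
  match delta q h with
  | None => None
  | Some (q', w, m) =>
    match m with
    | Stay => Some (q', l, w, r)
    | MoveL => match l with
               | [::] => Some (q', [::], Blank, w :: r)
               | x :: l' => Some (q', l', x, w :: r) end
    | MoveR => match r with
               | [::] => Some (q', w :: l, Blank, [::])
               | x :: r' => Some (q', w :: l, x, r') end
    end
  end.

Fixpoint run (M : TM) (fuel : nat) (c : config M) : option bool :=
  match fuel with
  | 0 => None
  | f.+1 => match step c with
            | None => Some (@accepting M c.1.1.1)
            | Some c' => run f c'
            end
  end.

Definition init_config (M : TM) (w : seq sym) : config M :=
  match w with
  | [::] => (start M, [::], Blank, [::])
  | x :: w' => (start M, [::], x, w')
  end.

Definition encode n (e : rel 'I_n) : seq sym :=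
  [seq (if e i j then S1 else S0) | i <- enum 'I_n, j <- enum 'I_n].

(* Main.v *)
(** A partition into at most [c] weakly semiregular sets is a colouring of the
    edges with [c] colours together with, for each colour [j], two bounds
    [a_j, b_j] such that every vertex has [0], [a_j] or [b_j] edges of colour [j].
    There are polynomially many choices of the bounds.  Once they are fixed, one
    computes for every ordered edge [uv] the set of colours which [uv] can have in
    a colouring that is correct on the side of [u]; these sets are the result of
    iterating a local pruning operator, and no root has to be chosen: a tree has a
    colouring iff the neighbours of one vertex can be coloured from their final
    sets.  Such a local problem only depends on the number of neighbours with each
    of the [2 ^ c] possible sets, and is solved by trying all the ways to split
    these numbers among the colours.

    All this is a nest of loops of constant depth over counters smaller than the
    length of the tape and over bit arrays of that length.  A counter is a mark on
    one cell, so every instruction is one left-to-right pass of a finite transducer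
    over a tape with a larger finite alphabet, and such passes are simulated on a
    tape of fixed-length bit blocks. *)
From HB Require Import structures.
Require Import Defs.
From mathcomp Require Import all_boot zify.
From mathcomp Require Import boolp.
Set Implicit Arguments. Unset Strict Implicit. Unset Printing Implicit Defensive.

(** * Turing machines running transducer passes *)

(** Connectedness and the edge count serve only [good_of_unpruned], where a colouring is extended
    vertex by vertex without conflict; that a colouring survives the pruning holds in every graph.
    Starting with nothing pruned, a monotone operator reaches its least fixed point in at most as
    many rounds as there are triples, [c * n * n]. Loops have the length [n * n] of the tape, so [c]
    of them suffice and no test for stabilisation is needed. The number [n] is not on the tape and
    is recovered from [n * n]. The exponent of the running time depends on [c], since the search for
    the bounds nests [2 * c] loops and the search for the splittings [c * 2 ^ c]. *)

Definition sym_code (x : sym) : option bool :=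
  match x with S0 => Some false | S1 => Some true | Blank => None end.
Definition sym_decode (o : option bool) : sym :=
  match o with Some false => S0 | Some true => S1 | None => Blank end.
Lemma sym_codeK : cancel sym_code sym_decode. Proof. by case. Qed.
(** The states of the compiled machine hold buffers of tape symbols, so finiteness of the state set
    needs finiteness of [sym]. *)
HB.instance Definition _ := Finite.copy sym (can_type sym_codeK).

Definition sym_of_bool (b : bool) : sym := if b then S1 else S0.

(** * Runs of a Turing machine as fuel equations *)

Section Reachability.
Variable M : TM.
Implicit Types c : config M.

(** [run] returns only a verdict, so reachability is expressed by its effect for every remaining
    fuel [f]. The exact step count [k] is hidden behind the bound [T], so that costs can be rounded
    up when runs are composed. *)
Definition goes (T : nat) c c' : Prop :=
  exists2 k, k <= T & forall f, run (k + f) c = run f c'.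

Lemma goes_refl T c : goes T c c.
Proof. by exists 0. Qed.

Lemma goes_trans T1 T2 c1 c2 c3 :
  goes T1 c1 c2 -> goes T2 c2 c3 -> goes (T1 + T2) c1 c3.
Proof.
case=> k1 k1T r1 [k2 k2T r2]; exists (k1 + k2); first exact: leq_add.
by move=> f; rewrite -addnA r1 r2.
Qed.

Lemma goes_step c c' : step c = Some c' -> goes 1 c c'.
Proof. by move=> e; exists 1 => // f /=; rewrite e. Qed.

Lemma goes_le T T' c c' : goes T c c' -> T <= T' -> goes T' c c'.
Proof. by case=> k kT r TT'; exists k => //; exact: leq_trans TT'. Qed.

(** The inequality is strict because [run] spends one unit of fuel on discovering that the last
    configuration halts. *)
Lemma goes_halt T fuel c c' :
  goes T c c' -> step c' = None -> T < fuel ->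
  run fuel c = Some (@accepting M c'.1.1.1).
Proof.
case=> k kT r halt Tf; have [g ->]: exists g, fuel = k + g.+1.
  by exists (fuel - k.+1); lia.
by rewrite r /= halt.
Qed.

(* The scanned cell is the head of [r], respectively the head of [l]; padding with blanks is
   implicit in both. *)
Definition cfgR q l r : config M := (q, l, head Blank r, behead r).
Definition cfgL q l r : config M := (q, behead l, head Blank l, r).

Lemma stepRR q l r q' w :
  delta q (head Blank r) = Some (q', w, MoveR) ->
  goes 1 (cfgR q l r) (cfgR q' (w :: l) (behead r)).
Proof. by move=> e; apply: goes_step; rewrite /= e; case: (behead r). Qed.

Lemma stepRL q l r q' w :
  delta q (head Blank r) = Some (q', w, MoveL) ->
  goes 1 (cfgR q l r) (cfgL q' l (w :: behead r)).
Proof. by move=> e; apply: goes_step; rewrite /= e; case: l. Qed.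

Lemma stepRS q l r q' w :
  delta q (head Blank r) = Some (q', w, Stay) ->
  goes 1 (cfgR q l r) (cfgR q' l (w :: behead r)).
Proof. by move=> e; apply: goes_step; rewrite /= e. Qed.

Lemma stepLL q l r q' w :
  delta q (head Blank l) = Some (q', w, MoveL) ->
  goes 1 (cfgL q l r) (cfgL q' (behead l) (w :: r)).
Proof. by move=> e; apply: goes_step; rewrite /= e; case: (behead l). Qed.

Lemma stepLR q l r q' w :
  delta q (head Blank l) = Some (q', w, MoveR) ->
  goes 1 (cfgL q l r) (cfgR q' (w :: behead l) r).
Proof. by move=> e; apply: goes_step; rewrite /= e; case: r. Qed.

Lemma stepLS q l r q' w :
  delta q (head Blank l) = Some (q', w, Stay) ->
  goes 1 (cfgL q l r) (cfgL q' (w :: behead l) r).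
Proof. by move=> e; apply: goes_step; rewrite /= e. Qed.

Lemma skipR q w l r :
  (forall x, x \in w -> delta q x = Some (q, x, MoveR)) ->
  goes (size w) (cfgR q l (w ++ r)) (cfgR q (rev w ++ l) r).
Proof.
elim: w l => [|x w IH] l qw /=; first exact: goes_refl.
rewrite -addn1 addnC rev_cons cat_rcons; apply: goes_trans; last first.
  by apply: IH => y yw; apply: qw; rewrite inE yw orbT.
by apply: stepRR; apply: qw; rewrite inE eqxx.
Qed.

Lemma skipL q w l r :
  (forall x, x \in w -> delta q x = Some (q, x, MoveL)) ->
  goes (size w) (cfgL q (w ++ l) r) (cfgL q l (rev w ++ r)).
Proof.
elim: w r => [|x w IH] r qw /=; first exact: goes_refl.
rewrite -addn1 addnC rev_cons cat_rcons; apply: goes_trans; last first.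
  by apply: IH => y yw; apply: qw; rewrite inE yw orbT.
by apply: stepLL; apply: qw; rewrite inE eqxx.
Qed.

End Reachability.

(** * Transducer passes and their simulation on a tape of blocks *)

Fixpoint sweep (Sg : Type) (f : option bool -> Sg -> option bool * Sg)
    (s : option bool) (t : seq Sg) : option bool * seq Sg :=
  match t with
  | [::] => (s, [::])
  | x :: t' => let: (s1, y) := f s x in
               let: (s2, t2) := sweep f s1 t' in (s2, y :: t2)
  end.

Lemma size_sweep (Sg : Type) f s (t : seq Sg) : size (sweep f s t).2 = size t.
Proof.
elim: t s => //= x t IH s; case: (f s x) => s1 y.
by have /= := IH s1; case: (sweep f s1 t) => s2 t2 /= ->.
Qed.

(* Each node makes one left-to-right pass over the tape, starting in memory state
   [None]; the final memory state selects the next node, or the exit value. *)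
Record mach (Sg : Type) := Mach {
  node : finType;
  entry : node;
  pass : node -> option bool -> Sg -> option bool * Sg;
  next : node -> option bool -> node + bool }.

(** The index [k] counts passes, not steps: all passes over a tape of fixed length obey the same
    cost bound, so the time is recovered by one multiplication. *)
Inductive reach (Sg : Type) (m : mach Sg) :
    node m -> seq Sg -> nat -> bool -> seq Sg -> Prop :=
| reach_exit q t s t' b :
    sweep (pass q) None t = (s, t') -> next q s = inr b -> reach q t 1 b t'
| reach_go q t s t1 q' k b t' :
    sweep (pass q) None t = (s, t1) -> next q s = inl q' ->
    reach q' t1 k b t' -> reach q t k.+1 b t'.

Section Compile.
Variables (Sg : finType) (x0 : Sg) (m : mach Sg) (inj : bool -> Sg).

Let B := #|Sg|.

(** One-hot code. All blocks have the same length and none contains a blank, so a blank always marks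
    the end of the coded tape. *)
Definition enc (x : Sg) : seq sym := [seq sym_of_bool (y == x) | y <- enum Sg].
Definition dec (s : seq sym) : Sg := odflt x0 [pick x | enc x == s].

Lemma size_enc x : size (enc x) = B.
Proof. by rewrite size_map -cardE. Qed.

Lemma encK : cancel enc dec.
Proof.
move=> x; rewrite /dec; case: pickP => [y /eqP e|/(_ x)]; last by rewrite eqxx.
have /eq_in_map/(_ x) := e; rewrite mem_enum => /(_ isT).
by rewrite eqxx; case: eqP.
Qed.

Lemma sym_of_bool_nonblank b : sym_of_bool b != Blank.
Proof. by case: b. Qed.

Lemma enc_nonblank x y : y \in enc x -> y != Blank.
Proof. by case/mapP => z _ ->; exact: sym_of_bool_nonblank. Qed.

Lemma card_Sg_gt0 : 0 < B.
Proof. by apply/card_gt0P; exists x0. Qed.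

Definition blocks (t : seq Sg) : seq sym := flatten [seq enc x | x <- t].

Lemma blocks_nonblank t y : y \in blocks t -> y != Blank.
Proof. by case/flatten_mapP => x _ /enc_nonblank. Qed.

Lemma size_blocks t : size (blocks t) = B * size t.
Proof.
by elim: t => [|x t IH]; rewrite ?muln0 //= size_cat size_enc mulnS -IH.
Qed.

(* Copying phase: [Seek] goes to the end of the input, [Take] erases its last
   symbol, which [CarryIn] and [CarryOut] take through the rest of the input and
   through the output; [Prepend] prepends its code block to the output.
   Simulation phase: [Pass q s i o] reads the block whose beginning is [i] while
   writing the block whose end is [o], so that each pass shifts the tape content
   by one block to the right. *)
Inductive ctl :=
| Seek | Take | Back
| CarryIn of bool | CarryOut of bool
| Prepend of B.-bseq sym
| Rewind of node m
| Pass of node m & option bool & B.-bseq sym & B.-bseq sym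
| Flush of node m & option bool & B.-bseq sym
| Halt of bool.

Definition ctl_code (q : ctl) :=
  match q with
  | Seek => inl (inl (inl (inl None)))
  | Take => inl (inl (inl (inl (Some false))))
  | Back => inl (inl (inl (inl (Some true))))
  | CarryIn b => inl (inl (inl (inr (false, b))))
  | CarryOut b => inl (inl (inl (inr (true, b))))
  | Prepend s => inl (inl (inr (inl s)))
  | Halt b => inl (inl (inr (inr b)))
  | Rewind n => inl (inr n)
  | Pass n s i o => inr (inl (n, s, i, o))
  | Flush n s o => inr (inr (n, s, o))
  end.
Definition ctl_decode c :=
  match c with
  | inl (inl (inl (inl None))) => Seek
  | inl (inl (inl (inl (Some false)))) => Take
  | inl (inl (inl (inl (Some true)))) => Back
  | inl (inl (inl (inr (false, b)))) => CarryIn b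
  | inl (inl (inl (inr (true, b)))) => CarryOut b
  | inl (inl (inr (inl s))) => Prepend s
  | inl (inl (inr (inr b))) => Halt b
  | inl (inr n) => Rewind n
  | inr (inl (n, s, i, o)) => Pass n s i o
  | inr (inr (n, s, o)) => Flush n s o
  end.
Lemma ctl_codeK : cancel ctl_code ctl_decode. Proof. by case. Qed.
HB.instance Definition _ := Finite.copy ctl (can_type ctl_codeK).

Notation bs := (insub_bseq B).

Lemma bsE (s : seq sym) : size s <= B -> bs s = s :> seq sym.
Proof. by move=> sB; rewrite /insub_bseq insubdK. Qed.

Definition ctl_delta (q : ctl) (h : sym) : option (ctl * sym * move) :=
  match q with
  | Seek => if h == Blank then Some (Take, Blank, MoveL) else Some (Seek, h, MoveR)
  | Take => match h with
            | Blank => Some (Rewind (entry m), Blank, MoveL)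
            | S0 => Some (CarryIn false, Blank, MoveL)
            | S1 => Some (CarryIn true, Blank, MoveL)
            end
  | CarryIn b => if h == Blank then Some (CarryOut b, Blank, MoveL)
                 else Some (CarryIn b, h, MoveL)
  | CarryOut b => if h == Blank then Some (Prepend (bs (rev (enc (inj b)))), Blank, Stay)
                  else Some (CarryOut b, h, MoveL)
  | Prepend s => if bseqval s is y :: s' then Some (Prepend (bs s'), y, MoveL)
             else Some (Back, h, MoveR)
  | Back => if h == Blank then Some (Seek, Blank, MoveR) else Some (Back, h, MoveR)
  | Rewind n => if h == Blank then Some (Pass n None (bs [::]) (bs (nseq B Blank)), Blank, MoveR)
                else Some (Rewind n, h, MoveL)
  | Pass n s i o =>
      if nilp i && (h == Blank) then Some (Flush n s o, Blank, Stay)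
      else if (size i).+1 == B then
        let: (s', y) := pass n s (dec (rcons i h)) in
        Some (Pass n s' (bs [::]) (bs (enc y)), head Blank o, MoveR)
      else Some (Pass n s (bs (rcons i h)) (bs (behead o)), head Blank o, MoveR)
  | Flush n s o =>
      if bseqval o is y :: o' then Some (Flush n s (bs o'), y, MoveR)
      else match next n s with
           | inl n' => Some (Rewind n', Blank, MoveL)
           | inr b => Some (Halt b, Blank, Stay)
           end
  | Halt _ => None
  end.

Definition machine : TM :=
  @Build_TM ctl Seek ctl_delta (fun q => if q is Halt true then true else false).

Notation go := (@goes machine).
Notation R := (@cfgR machine).
Notation L := (@cfgL machine).

Lemma head_nseq j : head Blank (nseq j Blank) = Blank. Proof. by case: j. Qed.
Lemma behead_nseq j : behead (nseq j Blank) = nseq j.-1 Blank. Proof. by case: j. Qed.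

Lemma prepend_goes s l j r : size s <= B -> l = nseq j Blank -> exists j',
  go (size s).+1 (L (Prepend (bs s)) l r) (R Back (nseq j' Blank) (rev s ++ r)).
Proof.
elim: s j l r => [|y s IH] j l r sB -> /=.
  exists j.-1.+1; rewrite -[nseq _.+1 _]/(Blank :: nseq _ _) -behead_nseq.
  by apply: (@stepLR machine); rewrite /= bsE // head_nseq.
have [j' g] := IH j.-1 _ (y :: r) (ltnW sB) erefl.
exists j'; rewrite rev_cons cat_rcons -[(size s).+2]add1n.
apply: goes_trans g; rewrite -(behead_nseq j); apply: (@stepLL machine) => /=.
by rewrite bsE.
Qed.

(** Invariant of the copying phase: the uncopied input [w], and to its left, after one separating
    blank, the code of the suffix [t] already consumed. Taking symbols from the end and prepending
    their codes keeps the order. The lengths of [w] and [t] have a constant sum, so one bound serves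
    every trip and the leading factor counts the trips. *)
Lemma copy_goes (w : seq bool) : forall t l r j i,
    head Blank l = Blank -> behead l = rev (blocks t) ++ nseq i Blank ->
    r = nseq j Blank ->
  exists i' j', go ((size w).+1 * (B * (size w + size t).+1 * 3 + size w * 2 + 10))
     (R Seek l (map sym_of_bool w ++ r))
     (L (Rewind (entry m)) (rev (blocks (map inj w ++ t)) ++ nseq i' Blank)
        (nseq j' Blank)).
Proof.
elim/last_ind: w => [|w x IH] t l r j i hl bl -> /=.
  exists i, j.-1.+2; apply: (@goes_le _ (1 + 1)); last by lia.
  apply: goes_trans.
    by apply: (@stepRL machine) => /=; rewrite head_nseq /=.
  rewrite behead_nseq -bl; apply: (@stepLL machine); by rewrite hl.
have h1 : forall z, z \in [seq sym_of_bool i | i <- rcons w x] -> ctl_delta Seek z = Some (Seek, z, MoveR).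
  by move=> z /mapP[b _ ->]; case: b.
(* One trip: go to the right end ([g1]), turn and erase the last symbol ([g2], [g3]), carry it left
   through the input, the separator and the output ([g4] to [g6]), write its block ([g7], [g8]),
   return over the output and the separator ([g9], [g10]). *)
have g1 := @skipR machine Seek _ l (nseq j Blank) h1.
have g2 : go 1 (R Seek (rev (map sym_of_bool (rcons w x)) ++ l) (nseq j Blank))
   (L Take (rev (map sym_of_bool (rcons w x)) ++ l) (Blank :: behead (nseq j Blank))).
  by apply: (@stepRL machine) => /=; rewrite head_nseq.
have g3 : go 1 (L Take (rev (map sym_of_bool (rcons w x)) ++ l) (Blank :: behead (nseq j Blank)))
   (L (CarryIn x) (rev (map sym_of_bool w) ++ l) [:: Blank, Blank & behead (nseq j Blank)]).
  rewrite map_rcons rev_rcons cat_cons; apply: (@stepLL machine) => /=; by case: (x).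
have h4 : forall z, z \in rev [seq sym_of_bool i | i <- w] -> ctl_delta (CarryIn x) z = Some (CarryIn x, z, MoveL).
  by move=> z; rewrite mem_rev; case/mapP=> b _ ->; case: b.
have g4 := @skipL machine (CarryIn x) _ l [:: Blank, Blank & behead (nseq j Blank)] h4.
rewrite revK in g4.
have g5 := @stepLL machine (CarryIn x) l (map sym_of_bool w ++ [:: Blank, Blank & behead (nseq j Blank)]) (CarryOut x) Blank.
rewrite /= hl /= in g5; have {}g5 := g5 erefl; rewrite bl in g5.
have h6 : forall z, z \in rev (blocks t) -> ctl_delta (CarryOut x) z = Some (CarryOut x, z, MoveL).
  by move=> z; rewrite mem_rev => /blocks_nonblank/negPf /= ->.
have g6 := @skipL machine (CarryOut x) _ (nseq i Blank)
   (Blank :: map sym_of_bool w ++ [:: Blank, Blank & behead (nseq j Blank)]) h6.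
rewrite revK in g6.
set r7 := blocks t ++ _ in g6.
have g7 := @stepLS machine (CarryOut x) (nseq i Blank) r7 (Prepend (bs (rev (enc (inj x))))) Blank.
rewrite /= head_nseq /= in g7; have {}g7 := g7 erefl.
rewrite behead_nseq in g7.
have sB : size (rev (enc (inj x))) <= B by rewrite size_rev size_enc.
have [i' g8] := prepend_goes r7 sB (erefl (nseq i.-1.+1 Blank)).
rewrite revK /r7 catA in g8.
have h9 : forall z, z \in enc (inj x) ++ blocks t -> ctl_delta Back z = Some (Back, z, MoveR).
  by move=> z; rewrite mem_cat => /orP[/enc_nonblank|/blocks_nonblank] /negPf /= ->.
have g9 := @skipR machine Back _ (nseq i' Blank) (Blank :: map sym_of_bool w ++ [:: Blank, Blank & behead (nseq j Blank)]) h9.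
set l9 := rev _ ++ _ in g9.
have g10 := @stepRR machine Back l9 (Blank :: map sym_of_bool w ++ [:: Blank, Blank & behead (nseq j Blank)]) Seek Blank erefl.
have [i'' [j'' g11]] := IH (inj x :: t) (Blank :: l9)
   [:: Blank, Blank & behead (nseq j Blank)] j.-1.+2 i' erefl erefl (congr1 (fun z => [:: Blank, Blank & z]) (behead_nseq j)).
exists i'', j''.
have := goes_trans (goes_trans (goes_trans (goes_trans (goes_trans (goes_trans (goes_trans (goes_trans (goes_trans (goes_trans g1 g2) g3) g4) g5) g6) g7) g8) g9) g10) g11.
rewrite (map_rcons inj) cat_rcons => g; apply: (goes_le g).
rewrite !size_rev !size_enc !size_map !size_cat ?size_rcons !size_enc size_blocks /=.
set a := size w; set d := size t.
have -> : (a + d.+1).+1 = a + d + 2 by lia.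
have -> : (a.+1 + d).+1 = a + d + 2 by lia.
have e : B * (a + d + 2) = B * a + B * d + B * 2 by rewrite !mulnDr.
rewrite [in X in _ <= X]mulSn.
have : a.+1 * (B * (a + d + 2) * 3 + a * 2 + 10) <= a.+1 * (B * (a + d + 2) * 3 + a.+1 * 2 + 10).
  by rewrite leq_mul2l; lia.
by rewrite e; lia.
Qed.

Lemma flush_goes n s o : forall l r j, r = nseq j Blank -> size o <= B -> exists j',
  go (size o) (R (Flush n s (bs o)) l r) (R (Flush n s (bs [::])) (rev o ++ l) (nseq j' Blank)).
Proof.
elim: o => [|y o IH] l r j -> oB; first by exists j; apply: goes_refl.
have [j' g] := IH (y :: l) _ j.-1 erefl (ltnW oB).
exists j'; rewrite /= rev_cons cat_rcons -[(size o).+1]add1n.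
apply: goes_trans g; rewrite -(behead_nseq j); apply: (@stepRR machine) => /=.
by rewrite bsE.
Qed.

(** The buffer [i] and the unread part [b] always make up one block, and [o] empties at the same
    rate as [b]; hence [o] is used up precisely when the block has been read and its successor can
    be loaded. *)
Lemma block_goes n s b : forall i o l r,
  size i + size b = B -> 0 < size b -> size o = size b ->
  (forall y, y \in b -> y != Blank) ->
  let: (s', y) := pass n s (dec (i ++ b)) in
  go (size b) (R (Pass n s (bs i) (bs o)) l (b ++ r))
     (R (Pass n s' (bs [::]) (bs (enc y))) (rev o ++ l) r).
Proof.
elim: b => // h b IH i [//|y o] l r szi _ [szo] nb.
have hB : (h == Blank) = false by apply: negbTE; apply: nb; rewrite inE eqxx.
have [b0|b0] := posnP (size b).
  have bn := size0nil b0; subst b; have on := size0nil szo; subst o.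
  rewrite cats1; case E: (pass n s _) => [s' z].
  have szB : (size i).+1 = B by move: szi; rewrite /= addn1.
  apply: (@stepRR machine) => /=; rewrite hB andbF !bsE /= ?szB ?eqxx ?E //; by rewrite -szB.
have szi' : size (rcons i h) + size b = B by rewrite size_rcons; move: szi => /=; lia.
have := IH (rcons i h) o (y :: l) r szi' b0 szo.
rewrite cat_rcons; case E: (pass n s _) => [s' z] /= g.
rewrite rev_cons cat_rcons -[(size b).+1]add1n.
apply: goes_trans (g _) => //; last by move=> x xb; apply: nb; rewrite inE xb orbT.
have szB : (size i).+1 < B by rewrite -szi /= addnS ltnS -[in X in X <= _]addn1 leq_add2l.
have szoB : (size o).+1 <= B by rewrite -szi szo leq_addl.
by apply: (@stepRR machine); rewrite /= hB andbF !bsE /= ?ltn_eqF // ltnW // ltnW.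
Qed.

(** The output lags one block behind the input: [o] is still to be written when reading starts, and
    the last block is written by [Flush] on the blank cells past the end. *)
Lemma pass_goes n t : forall s s' t' o l r j,
  sweep (pass n) s t = (s', t') -> size o = B -> r = nseq j Blank -> exists j',
  go (B * (size t).+1 + 1) (R (Pass n s (bs [::]) (bs o)) l (blocks t ++ r))
     (R (Flush n s' (bs [::])) (rev (o ++ blocks t') ++ l) (nseq j' Blank)).
Proof.
elim: t => [|x t IH] s s' t' o l r j /=.
  case=> <- <- szo ->.
  have [j' g] := @flush_goes n s o l _ j.-1.+1 erefl (eq_leq szo).
  exists j'; rewrite cats0; apply: (@goes_le _ (1 + size o)); last by rewrite szo muln1 addnC.
  apply: goes_trans g.
  rewrite -[nseq _.+1 _]/(Blank :: nseq _ _) -behead_nseq.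
  by apply: (@stepRS machine); rewrite /= bsE //= head_nseq.
case E1: (pass n s x) => [s1 y]; case E2: (sweep _ s1 t) => [s2 t2] [<- <-] szo rj.
have [j' g] := IH s1 s2 t2 (enc y) (rev o ++ l) r j E2 (size_enc y) rj.
exists j'.
have := @block_goes n s (enc x) [::] o l (blocks t ++ r).
rewrite !size_enc /= encK E1 => /(_ erefl card_Sg_gt0 szo (@enc_nonblank x)) g0.
have := goes_trans g0 g; rewrite -catA -[enc y ++ blocks t2]/(blocks (y :: t2)).
rewrite [rev (o ++ _)]rev_cat -catA => /goes_le; apply.
by rewrite !mulnS; lia.
Qed.

(** The paddings [i] and [j] are arbitrary because the content moves in each pass; its length stays
    the same, so all passes have the same cost bound. *)
Lemma reach_goes q t k b t' : reach q t k b t' ->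
  forall i j l r, l = nseq i Blank -> r = nseq j Blank -> 0 < size t -> exists c',
  [/\ step c' = None, @accepting machine c'.1.1.1 = b &
    go (k * (B * (size t) * 2 + B * 2 + 5)) (L (Rewind q) (rev (blocks t) ++ l) r) c'].
Proof.
have main : forall n u s u' i j l r, sweep (pass n) None u = (s, u') -> l = nseq i Blank -> r = nseq j Blank ->
   exists i' j', go (B * (size u) * 2 + B * 2 + 3) (L (Rewind n) (rev (blocks u) ++ l) r)
     (R (Flush n s (bs [::])) (rev (blocks u') ++ nseq i' Blank) (nseq j' Blank)).
  move=> n u s u' i j l r E -> ->.
  have h1 : forall z, z \in rev (blocks u) -> ctl_delta (Rewind n) z = Some (Rewind n, z, MoveL).
    by move=> z; rewrite mem_rev => /blocks_nonblank/negPf /= ->.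
  have g1 := @skipL machine (Rewind n) _ (nseq i Blank) (nseq j Blank) h1.
  rewrite revK in g1.
  have g2 : go 1 (L (Rewind n) (nseq i Blank) (blocks u ++ nseq j Blank))
    (R (Pass n None (bs [::]) (bs (nseq B Blank))) (Blank :: behead (nseq i Blank)) (blocks u ++ nseq j Blank)).
    by apply: (@stepLR machine); rewrite /= head_nseq.
  have [j' g3] := pass_goes (Blank :: behead (nseq i Blank)) E (size_nseq B Blank) (erefl (nseq j Blank)).
  (* A pass opens with a buffer of [B] blanks: they overwrite the first block and become part of the
     left padding. *)
  exists (B + i.-1.+1), j'; rewrite nseqD catA -{2}(size_nseq B Blank).
  have := goes_trans (goes_trans g1 g2) g3.
  rewrite size_nseq rev_cat rev_nseq behead_nseq /= => /goes_le; apply.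
  by rewrite size_rev size_blocks mulnS; lia.
elim=> {q t k b t'} [q t s t' b E nx|q t s t1 q' k b t' E nx rc IH] i j l r li rj t0.
  have [i' [j' g]] := main _ _ _ _ _ _ _ _ E li rj.
  exists (R (Halt b) (rev (blocks t') ++ nseq i' Blank) (Blank :: behead (nseq j' Blank))); split => //; first by case: (b).
  rewrite mul1n; apply: goes_le (goes_trans g _) _.
  - by apply: (@stepRS machine); rewrite /= bsE //= nx.
  - by lia.
have [i' [j' g]] := main _ _ _ _ _ _ _ _ E li rj.
have sz : size t1 = size t by rewrite -[t1]/((s, t1).2) -E size_sweep.
have [|c' [h a g']] := IH i' j'.-1.+1 _ _ erefl erefl; first by rewrite sz.
exists c'; split=> //.
have g2 : go 1 (R (Flush q s (bs [::])) (rev (blocks t1) ++ nseq i' Blank) (nseq j' Blank))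
  (L (Rewind q') (rev (blocks t1) ++ nseq i' Blank) (nseq j'.-1.+1 Blank)).
  rewrite -[nseq _.+1 _]/(Blank :: nseq _ _) -behead_nseq.
  by apply: (@stepRL machine); rewrite /= bsE //= nx.
apply: goes_le (goes_trans (goes_trans g g2) g') _.
by rewrite sz mulSn; lia.
Qed.

Lemma machine_correct (w : seq bool) k b t' fuel :
  0 < size w -> reach (entry m) (map inj w) k b t' ->
  (size w).+1 * (B * (size w).+1 * 3 + size w * 2 + 10) +
    k * (B * size w * 2 + B * 2 + 5) < fuel ->
  run fuel (init_config machine (map sym_of_bool w)) = Some b.
Proof.
move=> w0 rc fu.
have [i [j]] := @copy_goes w [::] [::] [::] 0 0 erefl erefl erefl.
rewrite !cats0 addn0 => g1.
have [|c' [h <- g2]] := reach_goes rc (erefl (nseq i Blank)) (erefl (nseq j Blank)); first by rewrite size_map.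
have := goes_trans g1 g2; rewrite size_map.
have -> : R Seek [::] (map sym_of_bool w) = init_config machine (map sym_of_bool w) by case: (w) w0.
by move=> g; apply: goes_halt g h fu.
Qed.

End Compile.

(** * A language of bounded loops and its compilation *)

Definition upd (T : eqType) (R : Type) (x : T) (y : R) (f : T -> R) : T -> R :=
  fun z => if z == x then y else f z.

Section Combinators.
Variable Sg : Type.
Implicit Types m : mach Sg.

Definition mach1 (f : option bool -> Sg -> option bool * Sg) : mach Sg :=
  @Mach Sg unit tt (fun _ => f) (fun _ s => inr (s == Some true)).

Definition branch m1 m2 m3 : mach Sg :=
  @Mach Sg (node m1 + node m2 + node m3)%type (inl (inl (entry m1)))
    (fun q => match q with
              | inl (inl q) => pass q | inl (inr q) => pass q | inr q => pass q
              end)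
    (fun q s => match q with
       | inl (inl q) => match next q s with
           | inl q' => inl (inl (inl q'))
           | inr b => inl (if b then inl (inr (entry m2)) else inr (entry m3))
           end
       | inl (inr q) => match next q s with
           | inl q' => inl (inl (inr q')) | inr b => inr b end
       | inr q => match next q s with inl q' => inl (inr q') | inr b => inr b end
       end).

(** The exit value of [m1] is discarded by branching to [m2] in both cases. The duplicated nodes are
    harmless, as the machine does not depend on the input. *)
Definition mseq m1 m2 := branch m1 m2 m2.

Definition while m1 m2 : mach Sg :=
  @Mach Sg (node m1 + node m2)%type (inl (entry m1))
    (fun q => match q with inl q => pass q | inr q => pass q end)
    (fun q s => match q with
       | inl q => match next q s with
           | inl q' => inl (inl q')
           | inr true => inl (inr (entry m2))
           | inr false => inr false
           end
       | inr q => match next q s with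
           | inl q' => inl (inr q') | inr _ => inl (inl (entry m1)) end
       end).

Lemma reach_mach1 f t s t' :
  sweep f None t = (s, t') -> reach (entry (mach1 f)) t 1 (s == Some true) t'.
Proof. by move=> e; apply: (@reach_exit _ (mach1 f) tt _ _ _ _ e). Qed.

(** No pass is spent on the hand-over: the exit of [m1] becomes a transition to the entry of its
    successor. The [emb] facts transport runs of the three parts to the combined machine. *)
Lemma reach_branch m1 m2 m3 t k1 b1 t1 k2 b2 t2 :
  reach (entry m1) t k1 b1 t1 ->
  (if b1 then reach (entry m2) t1 k2 b2 t2 else reach (entry m3) t1 k2 b2 t2) ->
  reach (entry (branch m1 m2 m3)) t (k1 + k2) b2 t2.
Proof.
set m := branch _ _ _ => r1 r2.
have emb2 q u k b u' : reach q u k b u' -> @reach _ m (inl (inr q)) u k b u'.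
  elim=> {q u k b u'} [q u s u' b E nx|q u s u1 q' k b u' E nx _ IH].
    by apply: (@reach_exit _ m _ _ s) => //=; rewrite nx.
  by apply: (@reach_go _ m _ _ s u1 (inl (inr q'))) => //=; rewrite nx.
have emb3 q u k b u' : reach q u k b u' -> @reach _ m (inr q) u k b u'.
  elim=> {q u k b u'} [q u s u' b E nx|q u s u1 q' k b u' E nx _ IH].
    by apply: (@reach_exit _ m _ _ s) => //=; rewrite nx.
  by apply: (@reach_go _ m _ _ s u1 (inr q')) => //=; rewrite nx.
pose tgt b : node m := if b then inl (inr (entry m2)) else inr (entry m3).
have {r2 emb2 emb3} r2 : reach (tgt b1) t1 k2 b2 t2.
  by case: (b1) r2 => /=; [apply: emb2|apply: emb3].
have emb1 q u k b u' : reach q u k b u' -> reach (tgt b) u' k2 b2 t2 ->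
    @reach _ m (inl (inl q)) u (k + k2) b2 t2.
  elim=> {q u k b u'} [q u s u' b E nx|q u s u1 q' k b u' E nx _ IH] r.
    by apply: (@reach_go _ m _ _ s u' (tgt b)) r => //=; rewrite nx.
  by apply: (@reach_go _ m _ _ s u1 (inl (inl q'))) (IH r) => //=; rewrite nx.
exact: emb1 r1 r2.
Qed.

Lemma reach_mseq m1 m2 t k1 b1 t1 k2 b2 t2 :
  reach (entry m1) t k1 b1 t1 -> reach (entry m2) t1 k2 b2 t2 ->
  reach (entry (mseq m1 m2)) t (k1 + k2) b2 t2.
Proof. by move=> r1 r2; apply: reach_branch r1 _; case: b1. Qed.

Lemma reach_while_exit m1 m2 t k t1 :
  reach (entry m1) t k false t1 -> reach (entry (while m1 m2)) t k false t1.
Proof.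
set m := while _ _.
have emb q u k' b u' : reach q u k' b u' -> b = false -> @reach _ m (inl q) u k' b u'.
  elim=> {q u k' b u'} [q u s u' b E nx|q u s u1 q' k' b u' E nx _ IH] e.
    by apply: (@reach_exit _ m _ _ s) => //=; rewrite nx e.
  by apply: (@reach_go _ m _ _ s u1 (inl q')) (IH e) => //=; rewrite nx.
by move=> r; apply: emb r _.
Qed.

Lemma reach_while_loop m1 m2 t k1 t1 k2 b2 t2 k3 b3 t3 :
  reach (entry m1) t k1 true t1 -> reach (entry m2) t1 k2 b2 t2 ->
  reach (entry (while m1 m2)) t2 k3 b3 t3 ->
  reach (entry (while m1 m2)) t (k1 + (k2 + k3)) b3 t3.
Proof.
set m := while _ _ => r1 r2 r3.
have emb2 q u k b u' : reach q u k b u' -> reach (entry m) u' k3 b3 t3 ->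
    @reach _ m (inr q) u (k + k3) b3 t3.
  elim=> {q u k b u'} [q u s u' b E nx|q u s u1 q' k b u' E nx _ IH] r.
    by apply: (@reach_go _ m _ _ s u' (inl (entry m1))) r => //=; rewrite nx.
  by apply: (@reach_go _ m _ _ s u1 (inr q')) (IH r) => //=; rewrite nx.
have emb1 q u k b u' : reach q u k b u' -> b = true ->
    @reach _ m (inr (entry m2)) u' (k2 + k3) b3 t3 ->
    @reach _ m (inl q) u (k + (k2 + k3)) b3 t3.
  elim=> {q u k b u'} [q u s u' b E nx|q u s u1 q' k b u' E nx _ IH] e r.
    by apply: (@reach_go _ m _ _ s u' (inr (entry m2))) r => //=; rewrite nx e.
  by apply: (@reach_go _ m _ _ s u1 (inl q')) (IH e r) => //=; rewrite nx.
exact: emb1 r1 _ (emb2 _ _ _ _ _ r2 r3).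
Qed.

End Combinators.

(** * Counters and bit arrays on the tape; instructions as single passes *)

Section Tape.
Variables H A : finType.
Implicit Types (hd : H -> nat) (ar : A -> nat -> bool) (h : H) (a : A).

Definition cell := ({ffun H -> bool} * {ffun A -> bool})%type.

Definition cell_at hd ar i : cell := ([ffun h => hd h == i], [ffun a => ar a i]).

Definition tape L hd ar : seq cell := [seq cell_at hd ar i | i <- iota 0 L].

Inductive test := Lt of H & H | On of H | Bit of A & H.

(* Counters that are at least [L] have no mark on the tape and compare as equal. *)
Definition holds L hd ar (b : test) : bool :=
  match b with
  | Lt h1 h2 => (hd h1 < hd h2) && (hd h1 < L)
  | On h => hd h < L
  | Bit a h => (hd h < L) && ar a (hd h)
  end.

(** For [Lt] the first mark met decides; asking for [h2] before [h1] makes two marks in the same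
    cell count as not less. *)
Definition test_sweep (b : test) (s : option bool) (x : cell) : option bool * cell :=
  (match b with
   | Lt h1 h2 => if s is Some _ then s
                 else if x.1 h2 then Some false else if x.1 h1 then Some true else None
   | On h => if x.1 h then Some true else s
   | Bit a h => if x.1 h then Some (x.2 a) else s
   end, x).

Definition set_head h (b : bool) (x : cell) : cell := (finfun (upd h b x.1), x.2).

Definition zero_sweep h (s : option bool) (x : cell) : option bool * cell :=
  (Some false, set_head h (s == None) x).

(** The state [Some true] carries the mark to the next cell. From the last cell the mark falls off
    the tape, and further increments leave the tape unchanged. *)
Definition inc_sweep h (s : option bool) (x : cell) : option bool * cell :=
  (if x.1 h then Some true else None, set_head h (s == Some true) x).

Definition put_sweep a h (b : bool) (s : option bool) (x : cell) : option bool * cell :=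
  (s, if x.1 h then (x.1, finfun (upd a b x.2)) else x).

(** This spares the instructions an induction over the tape: each is verified cell by cell from a
    guess [st i] of the memory state before cell [i]. *)
Lemma sweep_iota (Sg : Type) (f : option bool -> Sg -> option bool * Sg)
    (st : nat -> option bool) (g g' : nat -> Sg) L :
  (forall i, i < L -> f (st i) (g i) = (st i.+1, g' i)) ->
  sweep f (st 0) (map g (iota 0 L)) = (st L, map g' (iota 0 L)).
Proof.
move=> fst; suff: forall k n, k + n <= L ->
    sweep f (st k) (map g (iota k n)) = (st (k + n), map g' (iota k n)) by move=> /(_ 0 L (leqnn _)).
move=> k n; elim: n k => [|n IH] k kn; first by rewrite addn0.
by rewrite /= fst ?IH ?addSnnS //; lia.
Qed.

Lemma tape_ext L hd hd' ar ar' : hd =1 hd' -> (forall a, ar a =1 ar' a) ->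
  tape L hd ar = tape L hd' ar'.
Proof.
by move=> e1 e2; apply: eq_map => i; congr pair; apply/ffunP => x; rewrite !ffunE ?e1 ?e2.
Qed.

Lemma reach_test L hd ar b :
  reach (entry (mach1 (test_sweep b))) (tape L hd ar) 1 (holds L hd ar b) (tape L hd ar).
Proof.
pose st i := match b with
  | Lt h1 h2 => if minn (hd h1) (hd h2) < i then Some (hd h1 < hd h2) else None
  | On h => if hd h < i then Some true else None
  | Bit a h => if hd h < i then Some (ar a (hd h)) else None
  end.
have -> : holds L hd ar b = (st L == Some true).
  rewrite /st {st}; case: b => [h1 h2|h|a h] /=.
  - by case: (ltnP (hd h1) (hd h2)) => h12; rewrite /minn; case: ifP => //; case: ifP => //; lia.
  - by case: ifP.
  - by case: ifP => // _; case: (ar a _).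
have st0 : st 0 = None by rewrite /st {st}; case: b.
apply: reach_mach1; rewrite -st0; apply: sweep_iota => i _ {st0}.
congr pair; rewrite /st {st}; case: b => [h1 h2|h|a h] /=; rewrite ?ffunE.
- have [c1|c1] := ltnP (minn (hd h1) (hd h2)) i; first by rewrite ltnS (ltnW c1).
  case: (eqVneq (hd h2) i) => [e2|ne2].
    by rewrite ifT; [congr Some; lia|lia].
  case: (eqVneq (hd h1) i) => [e1|ne1]; first by rewrite ifT; [congr Some; lia|lia].
  by rewrite ifF //; lia.
- by case: (ltngtP (hd h) i) => c; rewrite ltnS; [rewrite (ltnW c)|rewrite leqNgt c|rewrite c leqnn].
- by case: (ltngtP (hd h) i) => c; rewrite ltnS; [rewrite (ltnW c)|rewrite leqNgt c|rewrite c leqnn].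
Qed.

Lemma reach_zero L hd ar h :
  exists b, reach (entry (mach1 (zero_sweep h))) (tape L hd ar) 1 b (tape L (upd h 0 hd) ar).
Proof.
eexists; apply: reach_mach1.
apply: (@sweep_iota _ _ (fun i => if i == 0 then None else Some false)) => i _.
rewrite /zero_sweep /set_head /cell_at /=; congr (_, (_, _)).
by apply/ffunP => k; rewrite !ffunE /upd ffunE; case: eqP => // _; case: i.
Qed.

Lemma reach_inc L hd ar h :
  exists b, reach (entry (mach1 (inc_sweep h))) (tape L hd ar) 1 b (tape L (upd h (hd h).+1 hd) ar).
Proof.
eexists; apply: reach_mach1.
apply: (@sweep_iota _ _ (fun i => if (hd h).+1 == i then Some true else None)) => i _.
rewrite /inc_sweep /set_head /cell_at /=; congr (_, (_, _)); first by rewrite ffunE eqSS.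
apply/ffunP => k; rewrite !ffunE /upd ffunE; have [_|//] := eqVneq k h.
by have [//|] := eqVneq _ i.
Qed.

Lemma reach_put L hd ar a h c :
  exists b, reach (entry (mach1 (put_sweep a h c))) (tape L hd ar) 1 b
    (tape L hd (upd a (upd (hd h) c (ar a)) ar)).
Proof.
eexists; apply: reach_mach1.
apply: (@sweep_iota _ _ (fun=> None)) => i _.
rewrite /put_sweep /cell_at /= ffunE; congr pair.
have [<-|ne] := eqVneq (hd h) i; congr pair; apply/ffunP => k; rewrite !ffunE /upd.
  by case: eqP => _; rewrite ?eqxx ?ffunE.
by case: eqP => // ->; rewrite eq_sym (negPf ne).
Qed.

End Tape.
Arguments On {H A}.
Arguments Lt {H A}.

(** * Loop programs and their running time *)

Section Language.
Variables V A : finType.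

(** [Rep] runs its body exactly [L] times and there is no other loop, so every program halts, in a
    number of passes polynomial in [L] with an exponent that depends on the program alone. *)
Inductive cmd :=
| Skip
| Zero of V
| Inc of V
| Put of A & V & bool
| Seq of cmd & cmd
| If of test V A & cmd & cmd
| Rep of cmd.

Record st := St { hd : V -> nat; ar : A -> nat -> bool }.

Fixpoint exec (L : nat) (c : cmd) (s : st) : st :=
  match c with
  | Skip => s
  | Zero v => St (upd v 0 (hd s)) (ar s)
  | Inc v => St (upd v (hd s v).+1 (hd s)) (ar s)
  | Put a v b => St (hd s) (upd a (upd (hd s v) b (ar s a)) (ar s))
  | Seq c1 c2 => exec L c2 (exec L c1 s)
  | If b c1 c2 => if holds L (hd s) (ar s) b then exec L c1 s else exec L c2 s
  | Rep c => iter L (exec L c) s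
  end.

Fixpoint depth (c : cmd) : nat :=
  match c with
  | Seq c1 c2 | If _ c1 c2 => maxn (depth c1) (depth c2)
  | Rep c => (depth c).+1
  | _ => 0
  end.

Variable D : nat.
Notation H := (V + 'I_D.+1)%type.

Definition lift_test (b : test V A) : test H A :=
  match b with
  | Lt v w => Lt (inl v) (inl w) | On v => On (inl v) | Bit a v => Bit a (inl v)
  end.

(* The loops of nesting level [l] count their iterations with the [l]-th
   additional head, which the program cannot access. *)
Fixpoint comp (l : nat) (c : cmd) : mach (cell H A) :=
  match c with
  | Skip => mach1 pair
  | Zero v => mach1 (zero_sweep (inl v))
  | Inc v => mach1 (inc_sweep (inl v))
  | Put a v b => mach1 (put_sweep a (inl v) b)
  | Seq c1 c2 => mseq (comp l c1) (comp l c2)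
  | If b c1 c2 => branch (mach1 (test_sweep (lift_test b))) (comp l c1) (comp l c2)
  | Rep c => mseq (mach1 (zero_sweep (inr (inord l))))
      (while (mach1 (test_sweep (On (inr (inord l)))))
         (mseq (comp l.+1 c) (mach1 (inc_sweep (inr (inord l))))))
  end.

Definition join (f : V -> nat) (g : 'I_D.+1 -> nat) (h : H) : nat :=
  match h with inl v => f v | inr i => g i end.

Definition tape_of L s g := tape L (join (hd s) g) (ar s).

Lemma join_updl f g v n : upd (inl v) n (join f g) =1 join (upd v n f) g.
Proof. by case. Qed.

Lemma join_updr f g i n : upd (inr i) n (join f g) =1 join f (upd i n g).
Proof. by case. Qed.

(** The loop counters [g] may hold anything on entry: a loop resets its own counter and uses only
    levels from [l] on, so the counters of the enclosing loops survive. *)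
Definition simulates L l c s k := forall g, exists K b g',
  [/\ reach (entry (comp l c)) (tape_of L s g) K b (tape_of L (exec L c s) g'),
      K <= (L + 2) ^ k & forall i : 'I_D.+1, i < l -> g' i = g i].

Lemma reach_tape_ext (m : mach (cell H A)) q t k b L hd hd' ar ar' :
  reach (m := m) q t k b (tape L hd ar) -> hd =1 hd' -> (forall a, ar a =1 ar' a) ->
  reach q t k b (tape L hd' ar').
Proof. by move=> r e1 e2; rewrite -(tape_ext L e1 e2). Qed.

(** The base [L + 2] is at least 2, so constant factors are absorbed by raising the exponent; two
    more factors cover the three summands. *)
Lemma sum_pow a b c L k1 k2 :
  a <= (L + 2) ^ k1 -> b <= (L + 2) ^ k2 -> c <= 1 -> a + b + c <= (L + 2) ^ (maxn k1 k2).+2.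
Proof.
move=> a1 b1 c1; rewrite !expnS.
have le k : k <= maxn k1 k2 -> (L + 2) ^ k <= (L + 2) ^ maxn k1 k2.
  by apply: leq_pexp2l; rewrite addn2.
have p0 : 0 < (L + 2) ^ maxn k1 k2 by rewrite expn_gt0 addn2.
have := le _ (leq_maxl k1 k2); have := le _ (leq_maxr k1 k2).
move: (_ ^ maxn _ _) p0 => P p0 h1 h2.
apply: (@leq_trans (2 * (2 * P))); first by lia.
by rewrite leq_mul // ?leq_mul //; lia.
Qed.

Lemma comp_correct c : exists k, forall L l s,
  l + depth c <= D -> 0 < L -> simulates L l c s k.
Proof.
elim: c => [|v|v|a v b|c1 [k1 IH1] c2 [k2 IH2]|b c1 [k1 IH1] c2 [k2 IH2]|c [k IH]].
- exists 0 => L l s _ _ g; exists 1, false, g; split => //.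
  rewrite /tape_of /tape; apply: (reach_mach1 (s := None)).
  by apply: (@sweep_iota _ _ (fun=> None)).
- exists 0 => L l s _ _ g.
  have [b r] := reach_zero L (join (hd s) g) (ar s) (inl v).
  by exists 1, b, g; split => //; apply: reach_tape_ext r (@join_updl _ _ _ _) _.
- exists 0 => L l s _ _ g.
  have [b r] := reach_inc L (join (hd s) g) (ar s) (inl v).
  by exists 1, b, g; split => //; apply: reach_tape_ext r (@join_updl _ _ _ _) _.
- exists 0 => L l s _ _ g.
  have [c r] := reach_put L (join (hd s) g) (ar s) a (inl v) b.
  by exists 1, c, g; split => //; apply: reach_tape_ext r _ _.
- exists (maxn k1 k2).+2 => L l s /= lD L0 g.
  have [|K1 [b1 [g1 [r1 le1 e1]]]] := IH1 L l s _ L0 g; first by lia.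
  have [|K2 [b2 [g2 [r2 le2 e2]]]] := IH2 L l (exec L c1 s) _ L0 g1; first by lia.
  exists (K1 + K2), b2, g2; split.
  + exact: reach_mseq r1 r2.
  + by rewrite -[K1 + K2]addn0; apply: sum_pow.
  + by move=> i il; rewrite e2 // e1.
- exists (maxn k1 k2).+2 => L l s /= lD L0 g.
  have r := reach_test L (join (hd s) g) (ar s) (lift_test b).
  have e : holds L (join (hd s) g) (ar s) (lift_test b) = holds L (hd s) (ar s) b.
    by case: (b).
  rewrite e in r.
  have [|K1 [b1 [g1 [r1 le1 e1]]]] := IH1 L l s _ L0 g; first by lia.
  have [|K2 [b2 [g2 [r2 le2 e2]]]] := IH2 L l s _ L0 g; first by lia.
  rewrite -[exec L _ s]/(if holds L (hd s) (ar s) b then exec L c1 s else exec L c2 s).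
  case: holds r => r.
    exists (1 + K1), b1, g1; split => //; first by apply: reach_branch r _; exact: r1.
    by rewrite addnC; apply: leq_trans (sum_pow le1 le2 (leqnn 1)); lia.
  exists (1 + K2), b2, g2; split => //; first by apply: reach_branch r _; exact: r2.
  by rewrite addnC; apply: leq_trans (sum_pow le1 le2 (leqnn 1)); lia.
- exists k.+3 => L l s /= lD L0 g.
  pose i0 : 'I_D.+1 := inord l.
  have i0E : i0 = l :> nat by rewrite inordK //; lia.
  have [b0 r0] := reach_zero L (join (hd s) g) (ar s) (inr i0).
  (* [n] is the number of iterations still to come. Each costs the body, one pass for the test and
     one for the increment; the failing test at the end gives the last [1]. *)
  have loop : forall n g1, n <= L -> g1 i0 = L - n -> (forall i : 'I_D.+1, i < l -> g1 i = g i) ->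
    exists K g2, [/\ reach (entry (while (mach1 (test_sweep (On (inr i0))))
         (mseq (comp l.+1 c) (mach1 (inc_sweep (inr i0))))))
         (tape_of L (iter (L - n) (exec L c) s) g1) K false
         (tape_of L (iter L (exec L c) s) g2),
         K <= n * ((L + 2) ^ k + 2) + 1 & forall i : 'I_D.+1, i < l -> g2 i = g i].
    elim=> [|n IHn] g1 nL g1n g1g.
      rewrite subn0 in g1n *; exists 1, g1; split => //.
      have := reach_test L (join (hd (iter L (exec L c) s)) g1) (ar (iter L (exec L c) s)) (On (inr i0)).
      by rewrite /= g1n ltnn; apply: reach_while_exit.
    set s1 := iter _ _ _.
    have [|K1 [b1 [g2 [r1 le1 e1]]]] := IH L l.+1 s1 _ L0 g1; first by lia.
    have g2i0 : g2 i0 = L - n.+1 by rewrite e1 ?i0E.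
    have [b2 r2] := reach_inc L (join (hd (exec L c s1)) g2) (ar (exec L c s1)) (inr i0).
    have [||i il|K2 [g3 [r3 le3 e3]]] := IHn (upd i0 (g2 i0).+1 g2).
    + by lia.
    + by rewrite /upd eqxx g2i0; lia.
    + rewrite /upd; case: eqP => [ii|_]; last by rewrite e1 ?g1g //; lia.
      by move: il; rewrite ii i0E ltnn.
    exists (1 + (K1 + 1 + K2)), g3; split => //; last by rewrite mulSn; lia.
    apply: reach_while_loop (reach_mseq r1 r2) _.
      have := reach_test L (join (hd s1) g1) (ar s1) (On (inr i0)).
      by rewrite [holds _ _ _ _]/= g1n ltn_subrL L0.
    rewrite (_ : tape _ _ _ = tape_of L (iter (L - n) (exec L c) s) (upd i0 (g2 i0).+1 g2)) //.
    have -> : L - n = (L - n.+1).+1 by lia.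
    by rewrite iterS; apply: tape_ext => // x; apply: join_updr.
  have [|i il|K [g2 [r le e]]] := loop L (upd i0 0 g) (leqnn L).
  + by rewrite /upd eqxx subnn.
  + by rewrite /upd; case: eqP => // ii; move: il; rewrite ii i0E ltnn.
  rewrite subnn /= in r.
  exists (1 + K), false, g2; split => //.
    apply: reach_mseq (r0) _.
    by rewrite (tape_ext L (join_updr _ _ _ _) (fun=> frefl _)).
  rewrite !expnS; have p0 : 0 < (L + 2) ^ k by rewrite expn_gt0 addn2.
  move: (_ ^ k) p0 le => P p0 le.
  apply: (@leq_trans ((L + 2) * (2 * (2 * P)))); last first.
    by rewrite leq_mul2l; apply/orP; right; rewrite leq_mul ?leq_mul //; lia.
  have : L * (P + 2) <= L * (3 * P) by rewrite leq_mul2l; lia.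
  by rewrite mulnDl; lia.
Qed.

End Language.

(** All counters start at [size w]: the coded input carries no marks, and a counter without a mark
    is one that has left the tape. *)
Definition initial (V A : finType) (a0 : A) (w : seq bool) : st V A :=
  St (fun=> size w) (fun a i => (a == a0) && nth false w i).

Theorem program_polytime (V A : finType) (a0 : A) (c : cmd V A) (b : test V A) :
  exists (M : TM) (k a : nat), forall w : seq bool, 0 < size w ->
    let s := exec (size w) c (initial V a0 w) in
    run (a * (size w).+1 ^ k) (init_config M (map sym_of_bool w)) =
      Some (holds (size w) (hd s) (ar s) b).
Proof.
have [k simc] := comp_correct (depth c) c.
pose H := (V + 'I_(depth c).+1)%type.
pose inj x : cell H A := ([ffun=> false], [ffun a => (a == a0) && x]).
pose m := mseq (comp (depth c) 0 c) (mach1 (test_sweep (lift_test (depth c) b))).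
pose B := #|{: cell H A}|.
(* Copying costs at most [3 * B + 12] times the square of [L + 1]. The number of passes is at most
   [(L + 2) ^ k + 1], and [L + 2 <= 2 * (L + 1)] gives the factor [2 ^ k]. *)
exists (machine (inj false) m inj), k.+2, (3 * B + 12 + 2 ^ k * 2 * (2 * B + 5) + 1).
move=> w w0 s; set L := size w in w0 s *.
have [|K [b1 [g [r Kk _]]]] := simc L 0 (initial V a0 w) _ w0 (fun=> L); first by [].
have e : map inj w = tape_of L (initial V a0 w) (fun=> L).
  rewrite -{1}(mkseq_nth false w) /mkseq -map_comp; apply/eq_in_map => i.
  rewrite mem_iota add0n => /andP[_ iL] /=; congr pair; apply/ffunP => x; rewrite !ffunE //.
  by case: x => x /=; rewrite gtn_eqF.
have eb : holds L (join (hd s) g) (ar s) (lift_test (depth c) b) = holds L (hd s) (ar s) b.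
  by case: (b).
have r2 := reach_test L (join (hd s) g) (ar s) (lift_test (depth c) b).
rewrite eb in r2; have := reach_mseq r r2; rewrite -e => r3.
apply: machine_correct (w0) r3 _; rewrite -/L -/B.
have le1 : (L + 2) ^ k <= 2 ^ k * L.+1 ^ k by rewrite -expnMn; case: (k) => // j; rewrite leq_exp2r //; lia.
have P0 : 0 < L.+1 ^ k by rewrite expn_gt0.
have Q0 : 0 < 2 ^ k by rewrite expn_gt0.
rewrite !expnS; move: (leq_trans Kk le1) P0 Q0; move: (L.+1 ^ k) (2 ^ k) => P Q KP P0 Q0.
have t1 : L.+1 * (B * L.+1 * 3 + L * 2 + 10) <= (3 * B + 12) * (L.+1 * (L.+1 * P)).
  apply: (@leq_trans ((3 * B + 12) * (L.+1 * L.+1))); last by rewrite !leq_mul2l leq_pmulr ?orbT.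
  by rewrite [X in _ <= X]mulnCA leq_mul2l /=; lia.
have t2 : (K + 1) * (B * L * 2 + B * 2 + 5) <= Q * 2 * (2 * B + 5) * (L.+1 * (L.+1 * P)).
  apply: (@leq_trans ((2 * (Q * P)) * ((2 * B + 5) * L.+1))).
    have QP0 : 0 < Q * P by rewrite muln_gt0 Q0.
    by apply: leq_mul; lia.
  rewrite (_ : 2 * _ * _ = Q * 2 * (2 * B + 5) * (L.+1 * P)); last by lia.
  by rewrite leq_mul2l leq_pmull ?orbT.
have T0 : 0 < L.+1 * (L.+1 * P) by rewrite !muln_gt0 P0.
move: t1 t2 T0; move: (L.+1 * (L.+1 * P)) => T t1 t2 T0.
by rewrite [X in _ < X]mulnDl [X in _ < X + _]mulnDl mul1n; lia.
Qed.

(** * Edge colourings of trees *)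

Section Colorings.
Variables (c n : nat) (e : rel 'I_n).
Implicit Types (a b : 'I_c -> nat) (u v w : 'I_n) (i j : 'I_c) (lst : 'I_n -> {set 'I_c}).

Definition allowed (a b d : nat) : bool := [|| d == 0, d == a | d == b].

Definition cdeg (k : 'I_n -> 'I_c) u j : nat := #|[set w | e u w && (k w == j)]|.

Definition feasible a b u lst : bool :=
  [exists k : {ffun 'I_n -> 'I_c},
     [forall w, e u w ==> (k w \in lst w)] &&
     [forall j, allowed (a j) (b j) (cdeg k u j)]].

Lemma feasibleP a b u lst : reflect
  (exists k : 'I_n -> 'I_c, (forall w, e u w -> k w \in lst w) /\
     forall j, allowed (a j) (b j) (cdeg k u j))
  (feasible a b u lst).
Proof.
apply: (iffP existsP) => [[k /andP[/forallP k1 /forallP k2]]|[k [k1 k2]]].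
  by exists k; split => // w; apply/implyP.
exists (finfun k); apply/andP; split; apply/forallP => j.
  by apply/implyP => /k1; rewrite ffunE.
rewrite (_ : cdeg _ u j = cdeg k u j) //.
by apply: eq_card => w; rewrite !inE ffunE.
Qed.

(* [(i, u, v) \in X] records that colour [i] is impossible for the edge [uv]
   because of the component of [u] in the tree without this edge. *)
Definition unpruned (X : {set 'I_c * 'I_n * 'I_n}) u w : {set 'I_c} :=
  [set j | (j, w, u) \notin X].

Definition pinned (X : {set 'I_c * 'I_n * 'I_n}) i u v w : {set 'I_c} :=
  if w == v then [set i] else unpruned X u w.

(** Enlarging [X] shrinks the lists and so enlarges the result; iteration from the empty set
    therefore leads to the least fixed point. Triples of pairs that are not edges have no influence,
    as [feasible] looks at neighbours only. *)
Definition prune a b (X : {set 'I_c * 'I_n * 'I_n}) : {set 'I_c * 'I_n * 'I_n} :=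
  [set t | ~~ feasible a b t.1.2 (pinned X t.1.1 t.1.2 t.2)].

Lemma prune_mono a b : {homo prune a b : X Y / X \subset Y}.
Proof.
move=> X Y XY; apply/subsetP => -[[i u] v]; rewrite !inE /=.
apply: contra => /feasibleP[k [k1 k2]]; apply/feasibleP; exists k; split => // w /k1.
rewrite /pinned; case: eqP => // _; rewrite !inE.
by apply: contra; apply: (subsetP XY).
Qed.

Definition good_coloring a b (k : 'I_n -> 'I_n -> 'I_c) : Prop :=
  (forall u w, e u w -> k u w = k w u) /\
  forall u j, allowed (a j) (b j) (cdeg (k u) u j).

Section Tree.
Hypothesis e_sym : forall x y, e x y = e y x.
Hypothesis e_irr : forall x, e x x = false.

(** The colours that [k] gives around [u] solve the local problem at [u], so no round can remove a
    colour that [k] uses. Cycles would do no harm here. *)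
Lemma good_unpruned a b k m : good_coloring a b k ->
  forall u v, e u v -> (k u v, u, v) \notin iter m (prune a b) set0.
Proof.
case=> ksym kd; elim: m => [|m IH] u v uv; first by rewrite inE.
rewrite inE negbK /=; apply/feasibleP; exists (k u); split => // w uw.
rewrite /pinned; case: eqP => [->|_]; first by rewrite inE.
by rewrite inE ksym // IH // e_sym.
Qed.

Definition edges_in (P : {set 'I_n}) := [set f in edges e | f \subset P].

Lemma edges_in_sub (P Q : {set 'I_n}) : P \subset Q -> edges_in P \subset edges_in Q.
Proof.
move=> PQ; apply/subsetP => f; rewrite !inE => /andP[-> fP].
exact: subset_trans fP PQ.
Qed.

Lemma edge_in x y : e x y -> [set x; y] \in edges e.
Proof. by move=> xy; apply/imset2P; exists x y => //; rewrite inE. Qed.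

Lemma edges_inU1 (P : {set 'I_n}) u v : u \notin P -> v \in P -> e u v ->
  #|edges_in P| < #|edges_in (u |: P)|.
Proof.
move=> uP vP uv; apply: proper_card; rewrite properE edges_in_sub ?subsetUr //=.
apply/subsetPn; exists [set u; v]; rewrite inE edge_in //=.
  by rewrite subUset !sub1set !inE eqxx vP orbT.
by rewrite subUset !sub1set (negPf uP).
Qed.

Lemma edges_inU1_twice (P : {set 'I_n}) u v v' :
  u \notin P -> v \in P -> v' \in P -> e u v -> e u v' -> v != v' ->
  (#|edges_in P|).+1 < #|edges_in (u |: P)|.
Proof.
move=> uP vP vP' uv uv' vv'; pose f := [set u; v].
have fP : f \notin edges_in P by rewrite inE subUset !sub1set (negPf uP) andbF.
have -> : (#|edges_in P|).+1 = #|f |: edges_in P| by rewrite cardsU1 fP.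
apply: proper_card; rewrite properE subUset edges_in_sub ?subsetUr // andbT sub1set.
rewrite inE edge_in //= subUset !sub1set !inE eqxx vP orbT /=.
apply/subsetPn; exists [set u; v']; rewrite ?inE ?edge_in //=.
  by rewrite subUset !sub1set !inE eqxx vP' orbT.
rewrite subUset !sub1set (negPf uP) /= orbF.
apply: contra vv' => /eqP/setP/(_ v'); rewrite !inE eqxx orbT => /esym/orP[/eqP v'u|/eqP->//].
by rewrite -v'u vP' in uP.
Qed.

Hypothesis e_conn : forall x y, connect e x y.
Hypothesis e_card : #|edges e| = n.-1.

Lemma crossing (P : {set 'I_n}) x0 : x0 \in P -> P != setT ->
  exists u v, [/\ u \notin P, v \in P & e u v].
Proof.
move=> x0P PT; apply: contrapT => H; case/eqP: PT; apply/setP => x.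
rewrite inE -(closed_connect _ (e_conn x0 x)) //.
move=> y z yz; apply/idP/idP => [yP|zP]; apply: contrapT => /negP N; case: H.
  by exists z, y; rewrite e_sym.
by exists y, z.
Qed.

(* Each vertex outside a set containing [x0] brings at least one new edge when it
   is reached from the set; in a tree it therefore cannot bring two. *)
Lemma edges_grow x0 m : forall P : {set 'I_n}, x0 \in P -> n - #|P| = m ->
  #|edges_in P| + m <= #|edges e|.
Proof.
elim: m => [|m IH] P x0P Pm.
  by rewrite addn0 subset_leq_card //; apply/subsetP => f; rewrite inE => /andP[].
have [|u [v [uP vP uv]]] := crossing x0P.
  by apply/eqP => PT; rewrite PT cardsT card_ord subnn in Pm.
apply: leq_trans (IH (u |: P) _ _); last by rewrite cardsU1 uP; lia.
  by rewrite addnS -addSn leq_add2r; apply: edges_inU1 vP uv.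
by rewrite inE x0P orbT.
Qed.

(** The coloured region [P] grows from [x0]. A new vertex [u] meets it in one vertex [v] only, and
    the colour of [uv] was not pruned; as [X] is a fixed point, this says that the colours around
    [u] can be completed, again with unpruned colours on the edges leaving the region. *)
Lemma good_of_unpruned a b (X : {set 'I_c * 'I_n * 'I_n}) x0 :
  prune a b X = X -> feasible a b x0 (unpruned X x0) -> exists k, good_coloring a b k.
Proof.
move=> XF /feasibleP[k0 [k01 k02]].
(* Invariant: [P] spans at least [#|P|.-1] edges, [k] is symmetric and correct at the vertices of
   [P], and the colour of an edge leaving [P] is unpruned as seen from its outer end [u]. *)
suff ext : forall m (P : {set 'I_n}) k, n - #|P| = m -> x0 \in P ->
   #|P|.-1 <= #|edges_in P| ->
   (forall u w, u \in P -> e u w -> k u w = k w u) ->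
   (forall u j, u \in P -> allowed (a j) (b j) (cdeg (k u) u j)) ->
   (forall v u, v \in P -> u \notin P -> e u v -> (k u v, u, v) \notin X) ->
   exists k, good_coloring a b k.
  apply: (ext (n - #|[set x0]|) [set x0] (fun x y => if x == x0 then k0 y else k0 x)) => //.
  - by rewrite inE.
  - by rewrite cards1.
  - move=> u w; rewrite inE => /eqP -> x0w; rewrite eqxx; case: eqP => // w0.
    by rewrite w0 e_irr in x0w.
  - by move=> u j; rewrite inE => /eqP ->; rewrite eqxx; apply: k02.
  - move=> v u; rewrite !inE => /eqP -> /negPf -> ux0.
    by have := k01 u; rewrite inE e_sym; apply.
elim=> [|m IH] P k Pm x0P Pe k1 k2 k3.
  have PT : P = setT.
    by apply/eqP; rewrite eqEcard subsetT cardsT card_ord -subn_eq0 Pm.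
  by exists k; split=> [u w|u j]; [apply: k1|apply: k2]; rewrite PT inE.
have P0 : 0 < #|P| by apply/card_gt0P; exists x0.
have [|u [v [uP vP uv]]] := crossing x0P.
  by apply/eqP => PT; rewrite PT cardsT card_ord subnn in Pm.
(* A second neighbour in [P] would bring two edges at once; with one edge for each of the [m]
   vertices still missing, the total would exceed [n.-1]. *)
have vu v' : v' \in P -> e u v' -> v' = v.
  move=> vP' uv'; apply/eqP; apply: contraT => vv'.
  have g1 := edges_inU1_twice uP vP' vP uv' uv vv'.
  have g2 : #|edges_in (u |: P)| + m <= #|edges e|.
    by apply: (@edges_grow x0); rewrite ?inE ?x0P ?orbT // cardsU1 uP; lia.
  by move: g1 g2; rewrite e_card; lia.
have := k3 v u vP uP uv; rewrite -{1}XF inE negbK /= => /feasibleP[ku [ku1 ku2]].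
have kuv : ku v = k u v by apply/eqP; have := ku1 v uv; rewrite /pinned eqxx inE.
(* Edges between [u] and the outside take the colours of [ku] in both orientations; a value [k x u]
   with [x] in [P] is kept, and for [x = v] it agrees with [ku v]. *)
pose k' x y := if x == u then ku y else if (y == u) && (x \notin P) then ku x else k x y.
have nu x : x \in P -> (x == u) = false by move=> xP; apply/eqP => xu; rewrite -xu xP in uP.
apply: (IH (u |: P) k').
- by rewrite cardsU1 uP; lia.
- by rewrite inE x0P orbT.
- by rewrite cardsU1 uP; have := edges_inU1 uP vP uv; lia.
- move=> x w; rewrite !inE /k' => /orP[/eqP -> uw|xP xw].
    rewrite eqxx /=; case: eqP => [wu|_]; first by rewrite wu e_irr in uw.
    have [wP|//] := boolP (w \in P); rewrite /= (vu w wP uw) kuv; apply/esym.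
    by apply: k1; rewrite // e_sym.
  rewrite (nu x xP) xP andbF /=; case: eqP => [wu|_]; last exact: k1.
  have xv : x = v by apply: vu => //; rewrite e_sym -wu.
  by rewrite wu xv kuv; apply: k1; rewrite // e_sym.
- move=> x j; rewrite !inE => /orP[/eqP ->|xP].
    by rewrite (_ : cdeg _ _ _ = cdeg ku u j) //; apply: eq_card => w; rewrite !inE /k' eqxx.
  rewrite (_ : cdeg _ _ _ = cdeg (k x) x j) ?k2 //.
  by apply: eq_card => w; rewrite !inE /k' nu // xP andbF.
- move=> x y; rewrite !inE => /orP[/eqP -> |xP] /norP[yu yP] yx; rewrite /k' (negPf yu).
    rewrite eqxx yP /=; have uy : e u y by rewrite e_sym.
    have := ku1 y uy; rewrite /pinned; case: eqP => [yv|_]; last by rewrite inE.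
    by rewrite yv vP in yP.
  by rewrite (nu x xP) /= k3.
Qed.

(** From left to right [fixset] is used as an iterate from the empty set, from right to left as a
    fixed point. *)
Lemma good_iff_feasible a b x0 :
  (exists k, good_coloring a b k) <->
  feasible a b x0 (unpruned (fixset (prune a b)) x0).
Proof.
split=> [[k kg]|]; last by apply: good_of_unpruned; apply: fixsetK; apply: prune_mono.
apply/feasibleP; exists (k x0); split => [w xw|j]; last by apply: kg.2.
by rewrite inE kg.1 //; apply: good_unpruned => //; rewrite e_sym.
Qed.

End Tree.
End Colorings.

(** * The weakly semiregular number in terms of colourings *)

Lemma leq_bigmin (I : Type) d (r : seq I) (P : pred I) (F : I -> nat) m :
  (\big[minn/d]_(i <- r | P i) F i <= m) = (d <= m) || has (fun i => P i && (F i <= m)) r.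
Proof.
elim: r => [|x r IH]; first by rewrite big_nil orbF.
by rewrite big_cons /=; case: (P x) => //=; rewrite geq_min IH orbCA.
Qed.

Section Number.
Variables (n : nat) (e : rel 'I_n).
Hypothesis simple : simple_graph e.

Let e_sym x y : e x y = e y x. Proof. exact: simple.1. Qed.
Let e_irr x : e x x = false. Proof. exact: simple.2. Qed.

Lemma preim_wsr_partition (T : finType) (col : {set 'I_n} -> T) :
  (forall i, weakly_semiregular [set f in edges e | col f == i]) ->
  wsr_partition e (preim_partition col (edges e)).
Proof.
move=> ws; split=> [|F /imsetP[f fe ->]]; first exact: preim_partitionP.
rewrite (_ : [set _ in _ | _] = [set g in edges e | col g == col f]) //.
by apply/setP => g; rewrite !inE eq_sym.
Qed.

(** Only an inequality, because a colour that no edge has yields no block. *)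
Lemma leq_card_preim_partition (T : finType) (col : {set 'I_n} -> T) :
  #|preim_partition col (edges e)| <= #|T|.
Proof.
apply: (@leq_trans #|[set [set g in edges e | col g == i] | i : T]|); last first.
  exact: leq_imset_card.
apply/subset_leq_card/subsetP => F /imsetP[f fe ->]; apply/imsetP; exists (col f) => //.
by apply/setP => g; rewrite !inE eq_sym.
Qed.

Lemma wr_leP m : 0 < m -> wr e <= m <->
  exists col : {set 'I_n} -> 'I_m, forall i, weakly_semiregular [set f in edges e | col f == i].
Proof.
case: m => // m _; split; last first.
  move=> [col /preim_wsr_partition wp]; rewrite /wr leq_bigmin; apply/orP; right.
  apply/hasP; exists (preim_partition col (edges e)); first by rewrite mem_index_enum.
  by apply/andP; split; [apply/asboolP|apply: leq_trans (leq_card_preim_partition col) _; rewrite card_ord].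
have from_partition P : wsr_partition e P -> #|P| <= m.+1 -> 
  exists col : {set 'I_n} -> 'I_m.+1, forall i, weakly_semiregular [set f in edges e | col f == i].
  case=> /and3P[/eqP cP tP _] ws Pm.
  exists (fun f => inord (index (pblock P f) (enum P))) => i.
  pose B := nth set0 (enum P) i.
  have inB f : f \in edges e -> inord (index (pblock P f) (enum P)) = i -> B \in P /\ f \in B.
    move=> fe; have bP : pblock P f \in P by rewrite pblock_mem // cP.
    have ix : index (pblock P f) (enum P) < m.+1.
      by apply: leq_trans Pm; rewrite cardE index_mem mem_enum.
    move=> ii; rewrite /B -ii inordK // nth_index ?mem_enum // mem_pblock cP //.
  have [E0|[f0]] := set_0Vmem [set f in edges e | inord (index (pblock P f) (enum P)) == i].
    by exists 0, 0 => v; rewrite E0 /degF setIdE set0I cards0.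
  rewrite inE => /andP[f0e /eqP f0i]; have [BP _] := inB f0 f0e f0i.
  rewrite (_ : [set f in _ | _] = B); first exact: ws.
  apply/setP => f; rewrite inE; apply/andP/idP => [[fe /eqP fi]|fB].
    by have [] := inB f fe fi.
  have fe : f \in edges e by rewrite -cP; apply/bigcupP; exists B.
  split=> //; rewrite (def_pblock tP BP fB) /B index_uniq ?enum_uniq ?inord_val //.
  have : B != set0 by apply/set0Pn; exists f.
  by apply: contraNT; rewrite -leqNgt => le; rewrite /B nth_default.
rewrite /wr leq_bigmin => /orP[le|/hasP[P _ /andP[/asboolP wp Pm]]]; last exact: from_partition wp Pm.
(* The case where the default value [#|edges e|] of the minimum is small enough: the partition into
   single edges serves, with degrees at most 1. *)
apply: (from_partition (preim_partition id (edges e))).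
  apply: preim_wsr_partition => f; exists 1, 1 => v; left.
  have : degF [set g in edges e | g == f] v <= 1 by
    rewrite -(cards1 f) subset_leq_card //; apply/subsetP => g; rewrite !inE => /andP[/andP[]].
  by move: H; case: degF => [|[]].
by apply: leq_trans le; apply: leq_imset_card.
Qed.

Lemma degF_cdeg m (col : {set 'I_n} -> 'I_m) i v :
  degF [set f in edges e | col f == i] v = cdeg e (fun w => col [set v; w]) v i.
Proof.
rewrite /degF /cdeg -(card_in_imset (f := fun w => [set v; w])); last first.
  move=> w w'; rewrite !inE => /andP[vw _] /andP[vw' _] /setP/(_ w).
  rewrite !inE eqxx orbT => /esym/orP[/eqP wv|/eqP//].
  by rewrite wv e_irr in vw.
apply: eq_card => f; rewrite !inE; apply/idP/imsetP => [|[w]]; last first.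
  rewrite inE => /andP[vw cf] ->; rewrite cf edge_in // !inE eqxx //.
case/andP=> /andP[/imset2P[x y _]]; rewrite inE => /andP[_ xy] -> ci.
rewrite !inE => /orP[/eqP vx|/eqP vy].
  by exists y; rewrite ?inE vx ?xy.
by exists x; rewrite ?inE vy setUC // e_sym xy.
Qed.

Lemma cdeg_lt m (k : 'I_n -> 'I_m) v i : cdeg e k v i < n.
Proof.
rewrite -[X in _ < X]card_ord -cardsT; apply: proper_card; rewrite properT.
by apply/eqP => /setP/(_ v); rewrite !inE e_irr.
Qed.

Lemma wr_good m N : 0 < m -> 0 < n -> n <= N -> wr e <= m <->
  exists a b : 'I_m -> nat, [/\ forall i, a i < N, forall i, b i < N &
    exists k, good_coloring e a b k].
Proof.
move=> m0 n0 nN; rewrite wr_leP //; split=> [[col ws]|[a [b [_ _ [k [ksym kd]]]]]].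
  pose k v w := col [set v; w].
  have /choice[ab H] : forall i, exists x : nat * nat,
     [/\ x.1 < N, x.2 < N & forall v, allowed x.1 x.2 (cdeg e (k v) v i)].
    move=> i; have [a [b h]] := ws i.
    (* All degrees are below [n], so a bound of [n] or more is never attained and can be replaced by
       0, a degree that is allowed anyway. *)
    exists (if a < n then a else 0, if b < n then b else 0); split.
    - by move=> /=; case: ifP; lia.
    - by move=> /=; case: ifP; lia.
    - move=> v; have := h v; rewrite degF_cdeg -/(k v) /allowed.
      case: posnP => [->//|_ /(_ isT)]; have dn := cdeg_lt (k v) v i.
      by case=> E; move: dn; rewrite E /= => ->; rewrite eqxx ?orbT.
  exists (fun i => (ab i).1), (fun i => (ab i).2); split; try by move=> i; have [] := H i.
  exists k; split=> [u w _|u j]; first by rewrite /k setUC.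
  by have [_ _] := H j.
(* Symmetry of [k] on edges makes the colour independent of the order of the ends; the default is
   for sets that are not edges. *)
pose col f := odflt (Ordinal m0) [pick i | [exists x, exists y, [&& e x y, f == [set x; y] & k x y == i]]].
have colE x y : e x y -> col [set x; y] = k x y.
  move=> xy; rewrite /col; case: pickP => [i /existsP[x' /existsP[y' /and3P[xy' /eqP E /eqP <-]]]|].
    have : x \in [set x'; y'] by rewrite -E !inE eqxx.
    have : y \in [set x'; y'] by rewrite -E !inE eqxx orbT.
    rewrite !inE => /orP[] /eqP yy /orP[] /eqP xx //=; rewrite ?xx ?yy.
    - by rewrite xx yy e_irr in xy.
    - by apply: ksym.
    - by [].
    - by rewrite xx yy e_irr in xy.
  by move=> /(_ (k x y))/existsP[]; exists x; apply/existsP; exists y; rewrite xy !eqxx.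
exists col => i; exists (a i), (b i) => v.
rewrite degF_cdeg (_ : cdeg _ _ v i = cdeg e (k v) v i); last first.
  by apply: eq_card => w; rewrite !inE; case vw: (e v w) => //=; rewrite colE.
by have := kd v i; rewrite /allowed; case: cdeg => //= d /orP[] /eqP <-; [left|right].
Qed.

End Number.

(** * The local problem depends only on counts *)

Section Counts.
Variables (c n : nat) (e : rel 'I_n).
Hypothesis c_gt0 : 0 < c.

(** The list [s] with [x j] copies of each [j] is as long as [enum W]; matching the two gives
    [f]. *)
Lemma fibres_exist (T : finType) (W : {set T}) (A : {set 'I_c}) (x : 'I_c -> nat) :
  \sum_(j in A) x j = #|W| ->
  exists f : T -> 'I_c, (forall w, w \in W -> f w \in A) /\
    forall j, j \in A -> #|[set w in W | f w == j]| = x j.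
Proof.
move=> xW; pose s := flatten [seq nseq (x j) j | j <- enum A].
have sW : size s = #|W|.
  rewrite size_flatten /shape -map_comp sumnE big_map big_enum /= -xW.
  by apply: eq_bigr => j _; rewrite /= size_nseq.
pose f w := nth (Ordinal c_gt0) s (index w (enum W)).
have fs : map f (enum W) = s.
  apply: (@eq_from_nth _ (Ordinal c_gt0)); first by rewrite size_map -cardE sW.
  move=> i; rewrite size_map => iW; case E: (enum W) iW => [//|w0 r]; rewrite -E => iW.
  by rewrite (nth_map w0) // /f index_uniq ?enum_uniq.
exists f; split=> [w wW|j jA].
  have : f w \in s by rewrite -fs map_f ?mem_enum.
  by case/flatten_mapP => j; rewrite mem_enum => jA; rewrite mem_nseq => /andP[_ /eqP->].
have -> : #|[set w in W | f w == j]| = count (preim f (pred1 j)) (enum W).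
  rewrite -size_filter -(card_uniqP (filter_uniq _ (enum_uniq _))).
  by apply: eq_card => w; rewrite !inE mem_filter mem_enum andbC.
rewrite -count_map fs count_flatten -map_comp sumnE big_map big_enum /= (bigD1 j) //=.
rewrite count_nseq /= eqxx mul1n big1 ?addn0 // => i /andP[_ ij].
by rewrite count_nseq /= (negPf ij).
Qed.

(** Neighbours with the same list [A] are interchangeable, so a solution is described by the numbers
    [x A j] of those that receive colour [j]. How many such numbers there are depends on [c] alone,
    and each is below [m], so loops can search them. *)
Lemma feasible_counts (a b : 'I_c -> nat) u (lst : 'I_n -> {set 'I_c}) m :
  #|[set w | e u w]| < m ->
  feasible e a b u lst <->
  exists x : {set 'I_c} -> 'I_c -> nat,
   [/\ forall A j, x A j < m,
     forall A : {set 'I_c}, \sum_(j in A) x A j = #|[set w | e u w && (lst w == A)]| &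
     forall j, allowed (a j) (b j) (\sum_(A : {set 'I_c} | j \in A) x A j)].
Proof.
move=> um; split=> [/feasibleP[k [k1 k2]]|[x [_ x1 x2]]].
  pose x (A : {set 'I_c}) j := #|[set w | [&& e u w, lst w == A & k w == j]]|.
  exists x; split => [A j|A|j].
  - apply: leq_ltn_trans um.
    by apply/subset_leq_card/subsetP => w; rewrite !inE => /andP[].
  - rewrite -sum1_card (partition_big k (mem A)) /=; last first.
      by move=> w; rewrite inE => /andP[uw /eqP <-]; apply: k1.
    apply: eq_bigr => j _; rewrite sum1_card /x; apply: eq_card => w.
    by rewrite inE unfold_in /= !inE -!andbA.
  - rewrite (_ : \sum_(A : {set 'I_c} | j \in A) x A j = cdeg e k u j) ?k2 //.
    rewrite /cdeg -sum1_card (partition_big lst (fun A => j \in A)) /=; last first.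
      by move=> w; rewrite inE => /andP[uw /eqP <-]; apply: k1.
    apply: eq_bigr => A _; rewrite sum1_card /x; apply: eq_card => w.
    by rewrite inE unfold_in /= !inE -!andbA; congr andb; rewrite andbC.
have /choice[f fP] := fun A => fibres_exist (x1 A).
apply/feasibleP; exists (fun w => f (lst w) w); split => [w uw|j].
  by apply: (fP _).1; rewrite inE uw eqxx.
rewrite (_ : cdeg _ _ _ _ = \sum_(A : {set 'I_c} | j \in A) x A j) ?x2 //.
rewrite /cdeg -sum1_card (partition_big lst (fun A => j \in A)) /=; last first.
  by move=> w; rewrite inE => /andP[uw /eqP <-]; apply: (fP _).1; rewrite inE uw eqxx.
apply: eq_bigr => A jA; rewrite -(fP A).2 // sum1_card; apply: eq_card => w.
rewrite !inE unfold_in /= !inE; case: (e u w) => //=.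
by case: (eqVneq (lst w) A) => [->|]; rewrite ?andbT ?andbF.
Qed.

End Counts.

(** * Reasoning about loop programs *)

Section ProgramLogic.
Variables (V A : finType) (L : nat).
Implicit Types (c : cmd V A) (s : st V A).
Notation exec := (exec L).

Fixpoint touches c (v : V) : bool :=
  match c with
  | Zero w | Inc w => v == w
  | Seq c1 c2 | If _ c1 c2 => touches c1 v || touches c2 v
  | Rep c => touches c v
  | _ => false
  end.

Fixpoint writes c (a : A) : bool :=
  match c with
  | Put a' _ _ => a == a'
  | Seq c1 c2 | If _ c1 c2 => writes c1 a || writes c2 a
  | Rep c => writes c a
  | _ => false
  end.

Lemma touches_seq c1 c2 v : touches (Seq c1 c2) v = touches c1 v || touches c2 v.
Proof. by []. Qed.

Lemma touches_if b c1 c2 v : touches (If b c1 c2) v = touches c1 v || touches c2 v.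
Proof. by []. Qed.

Lemma writes_seq c1 c2 a : writes (Seq c1 c2) a = writes c1 a || writes c2 a.
Proof. by []. Qed.

Lemma writes_if b c1 c2 a : writes (If b c1 c2) a = writes c1 a || writes c2 a.
Proof. by []. Qed.

(** Frame condition with the variables and arrays that may change. The loop rules hand it to each
    iteration with syntactic [F] and [G], so that invariants need not repeat what is unmodified. *)
Definition same (F : pred V) (G : pred A) s s' : Prop :=
  (forall v, ~~ F v -> hd s' v = hd s v) /\ (forall a, ~~ G a -> ar s' a = ar s a).

Lemma same_refl F G s : same F G s s. Proof. by []. Qed.

Lemma same_trans F G s1 s2 s3 : same F G s1 s2 -> same F G s2 s3 -> same F G s1 s3.
Proof.
by case=> h1 a1 [h2 a2]; split=> [v vF|a aG]; [rewrite h2 ?h1|rewrite a2 ?a1].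
Qed.

Lemma same_sub (F F' : pred V) (G G' : pred A) s s' :
  subpred F F' -> subpred G G' -> same F G s s' -> same F' G' s s'.
Proof.
move=> FF GG [h a]; split=> [v vF|b bG]; [apply: h|apply: a].
  by apply: contra vF; apply: FF.
by apply: contra bG; apply: GG.
Qed.

Lemma same_exec c s : same (touches c) (writes c) s (exec c s).
Proof.
elim: c s => //=.
- by move=> v s; split=> //= w; rewrite /upd => /negPf ->.
- by move=> v s; split=> //= w; rewrite /upd => /negPf ->.
- by move=> a v b s; split=> //= w; rewrite /upd => /negPf ->.
- move=> c1 IH1 c2 IH2 s; apply: (@same_trans _ _ _ (exec c1 s)).
    by apply: same_sub (IH1 s) => x /= ->.
  by apply: same_sub (IH2 _) => x /= ->; rewrite orbT.
- move=> b c1 IH1 c2 IH2 s; case: ifP => _.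
    by apply: same_sub (IH1 s) => x /= ->.
  by apply: same_sub (IH2 s) => x /= ->; rewrite orbT.
- move=> c IH s; elim: {1}L => [|n IHn]; first exact: same_refl.
  by rewrite iterS; apply: same_trans IHn (IH _).
Qed.

Lemma frame_hd c s v : ~~ touches c v -> hd (exec c s) v = hd s v.
Proof. exact: (same_exec c s).1. Qed.

Lemma frame_ar c s a : ~~ writes c a -> ar (exec c s) a = ar s a.
Proof. exact: (same_exec c s).2. Qed.

Definition seqs (l : seq (cmd V A)) : cmd V A := foldr (@Seq V A) (Skip V A) l.

Lemma touches_seqs l v : touches (seqs l) v = has (fun c => touches c v) l.
Proof. by elim: l => //= c l ->. Qed.

Lemma writes_seqs l a : writes (seqs l) a = has (fun c => writes c a) l.
Proof. by elim: l => //= c l ->. Qed.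

Lemma touches_map (T : Type) (f : T -> cmd V A) l v :
  touches (seqs (map f l)) v = has (fun t => touches (f t) v) l.
Proof. by rewrite touches_seqs has_map. Qed.

Lemma writes_map (T : Type) (f : T -> cmd V A) l a :
  writes (seqs (map f l)) a = has (fun t => writes (f t) a) l.
Proof. by rewrite writes_seqs has_map. Qed.

Lemma seqs_ind (T : eqType) (f : T -> cmd V A) (I : seq T -> st V A -> Prop) l s :
  I [::] s ->
  (forall t l1 s1, t \in l -> same (touches (seqs (map f l))) (writes (seqs (map f l))) s s1 ->
     I l1 s1 -> I (rcons l1 t) (exec (f t) s1)) ->
  I l (exec (seqs (map f l)) s).
Proof.
set F := touches _; set G := writes _ => I0 Is.
suff H : forall l2 l1 s1, l = l1 ++ l2 -> same F G s s1 -> I l1 s1 -> I l (exec (seqs (map f l2)) s1).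
  by apply: (H l [::]).
elim=> [|t l2 IH] l1 s1 El ss1 I1; first by rewrite El cats0.
have tl : t \in l by rewrite El mem_cat inE eqxx orbT.
apply: (IH (rcons l1 t)); rewrite ?cat_rcons //; last exact: Is.
apply: same_trans ss1 _; apply: same_sub (same_exec (f t) s1) => x xt.
  by rewrite /F touches_map; apply/hasP; exists t.
by rewrite /G writes_map; apply/hasP; exists t.
Qed.

Lemma seqs_fold (T : eqType) (f : T -> cmd V A) (X : Type) (obs : st V A -> X)
    (next : X -> T -> X) l s :
  (forall t s1, t \in l -> same (touches (seqs (map f l))) (writes (seqs (map f l))) s s1 ->
     obs (exec (f t) s1) = next (obs s1) t) ->
  obs (exec (seqs (map f l)) s) = foldl next (obs s) l.
Proof.
move=> step.
apply: (@seqs_ind T f (fun l1 s1 => obs s1 = foldl next (obs s) l1)) => // t l1 s1 tl ss1 e.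
by rewrite step // e foldl_rcons.
Qed.

Lemma seqs_sum (T : eqType) (f : T -> cmd V A) (v : V) (g : T -> nat) l s :
  (forall t s1, t \in l -> same (touches (seqs (map f l))) (writes (seqs (map f l))) s s1 ->
     hd (exec (f t) s1) v = hd s1 v + g t) ->
  hd (exec (seqs (map f l)) s) v = hd s v + \sum_(t <- l) g t.
Proof.
move=> step; have /= -> := seqs_fold (obs := fun s => hd s v) (next := fun x t => x + g t) step.
by elim: l {step} (hd s v) => [|t l IH] x; rewrite ?big_nil ?addn0 //= IH big_cons addnA.
Qed.

Lemma seqs_all (T : eqType) (f : T -> cmd V A) (v : V) (P : pred T) l s :
  (forall t s1, t \in l -> same (touches (seqs (map f l))) (writes (seqs (map f l))) s s1 ->
     (0 < hd (exec (f t) s1) v) = (0 < hd s1 v) && P t) ->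
  (0 < hd (exec (seqs (map f l)) s) v) = (0 < hd s v) && all P l.
Proof.
move=> step; have /= -> := seqs_fold (obs := fun s => 0 < hd s v) (next := fun x t => x && P t) step.
by elim: l {step} (0 < _) => [|t l IH] x /=; rewrite ?andbT // IH andbA.
Qed.

(** Meant for a property that one particular item [t0] establishes and every item preserves, such as
    the content of an array cell. *)
Lemma seqs_reach (T : eqType) (f : T -> cmd V A) (good : st V A -> Prop) (t0 : T) l s :
  (forall t s1, t \in l -> same (touches (seqs (map f l))) (writes (seqs (map f l))) s s1 ->
     good s1 \/ t = t0 -> good (exec (f t) s1)) ->
  good s \/ t0 \in l -> good (exec (seqs (map f l)) s).
Proof.
move=> step g0.
have : good (exec (seqs (map f l)) s) \/ ~ (good s \/ t0 \in l).
  apply: (@seqs_ind T f (fun l1 s1 => good s1 \/ ~ (good s \/ t0 \in l1))).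
    have [g|ng] := pselect (good s); first by left.
    by right=> -[].
  move=> t l1 s1 tl ss1 [g|ng]; first by left; apply: step => //; left.
  have [t_t0|ne] := eqVneq t t0; first by left; apply: step => //; right.
  by right; rewrite mem_rcons inE eq_sym (negPf ne).
by case.
Qed.

Definition for_ v c : cmd V A := Seq (Zero A v) (Rep (Seq c (Inc A v))).

Lemma touches_for v c w : touches (for_ v c) w = (w == v) || touches c w.
Proof. by rewrite /=; case: (w == v); rewrite ?orbT ?orbF. Qed.

Lemma writes_for v c a : writes (for_ v c) a = writes c a.
Proof. by rewrite /= orbF. Qed.

Lemma for_ind v c (I : nat -> st V A -> Prop) s : ~~ touches c v ->
  I 0 (St (upd v 0 (hd s)) (ar s)) ->
  (forall i s1, i < L -> hd s1 v = i -> same (touches (for_ v c)) (writes (for_ v c)) s s1 ->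
     I i s1 -> let s2 := exec c s1 in I i.+1 (St (upd v i.+1 (hd s2)) (ar s2))) ->
  I L (exec (for_ v c) s).
Proof.
set F := touches (for_ v c); set G := writes (for_ v c) => vc I0 Is /=.
set s0 := St _ _ in I0 *.
suff H : forall n, n <= L -> let s1 := iter n (fun s => St (upd v (hd (exec c s) v).+1 (hd (exec c s))) (ar (exec c s))) s0 in
    [/\ hd s1 v = n, same F G s s1 & I n s1] by have [] := H L (leqnn L).
elim=> [_|n IH nL].
  split => //=; first by rewrite /upd eqxx.
  by split=> //= w; rewrite /F touches_for /upd; case: eqP.
have [hn ssn In] := IH (ltnW nL); set s1 := iter n _ _ in hn ssn In *.
rewrite iterS -/s1 /= frame_hd // hn; split; first by rewrite /upd eqxx.
  apply: same_trans ssn _; split=> [w|a] /=.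
    by rewrite /F touches_for /upd; case: eqP => //= _; apply: frame_hd.
  by rewrite /G writes_for; apply: frame_ar.
exact: Is.
Qed.

Lemma for_sum v c w (f : nat -> nat) s : ~~ touches c v -> w != v ->
  (forall i s1, i < L -> hd s1 v = i -> same (touches (for_ v c)) (writes (for_ v c)) s s1 ->
     hd (exec c s1) w = hd s1 w + f i) ->
  hd (exec (for_ v c) s) w = hd s w + \sum_(i < L) f i.
Proof.
move=> vc wv step.
apply: (for_ind (I := fun n s1 => hd s1 w = hd s w + \sum_(i < n) f i)) => //.
  by rewrite big_ord0 addn0 /= /upd (negPf wv).
move=> i s1 iL vi ss1 e s2.
by rewrite /= /upd (negPf wv) /s2 (step i) // e big_ord_recr /= addnA.
Qed.

(** [good] may depend only on the arrays, since the loop keeps changing its own counter. *)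
Lemma for_reach v c (good : st V A -> Prop) i0 s : ~~ touches c v ->
  (forall s s', ar s = ar s' -> good s -> good s') ->
  (forall i s1, i < L -> hd s1 v = i -> same (touches (for_ v c)) (writes (for_ v c)) s s1 ->
     good s1 \/ i = i0 -> good (exec c s1)) ->
  good s \/ i0 < L -> good (exec (for_ v c) s).
Proof.
move=> vc gar step g0.
have : good (exec (for_ v c) s) \/ ~ (good s \/ i0 < L).
  apply: (for_ind (I := fun n s1 => good s1 \/ ~ (good s \/ i0 < n))) => //.
    have [g|ng] := pselect (good s); first by left; apply: gar g.
    by right=> -[].
  move=> i s1 iL vi ss1 [g|ng] s2.
    by left; apply: (gar s2) => //; apply: step vi ss1 _ => //; left.
  have [ii0|ne] := eqVneq i i0.
    by left; apply: (gar s2) => //; apply: step vi ss1 _ => //; right.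
  right=> -[g|]; first by apply: ng; left.
  by rewrite ltnS leq_eqVlt eq_sym (negPf ne) /= => lt; apply: ng; right.
by case.
Qed.

Definition loops (vs : seq V) c : cmd V A := foldr for_ c vs.

Lemma touches_loops vs c w : touches (loops vs c) w = (w \in vs) || touches c w.
Proof. by elim: vs => //= v vs IH; rewrite -/(loops vs c) IH inE; case: (w == v); rewrite ?orbT ?orbF. Qed.

Lemma writes_loops vs c a : writes (loops vs c) a = writes c a.
Proof. by elim: vs => //= v vs IH; rewrite orbF. Qed.

(** Exhaustive search by nested loops: [r] is a flag that the body raises when [g] accepts the
    current values and never lowers. The induction fixes the value [i] of the outermost variable,
    which turns [g] into [fun h => g (upd v i h)]. *)
Lemma loops_exists vs c r (g : (V -> nat) -> bool) s :
  uniq vs -> all (fun v => ~~ touches c v) vs -> r \notin vs ->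
  (forall h h', {in vs, h =1 h'} -> g h = g h') ->
  (forall s1, same (touches (loops vs c)) (writes c) s s1 -> {in vs, forall v, hd s1 v < L} ->
     (0 < hd (exec c s1) r) = (0 < hd s1 r) || g (hd s1)) ->
  0 < hd (exec (loops vs c) s) r <->
  0 < hd s r \/ exists2 h, {in vs, forall v, h v < L} & g h.
Proof.
elim: vs g s => [|v vs IH] g s /=.
  move=> _ _ _ gE /(_ s) ->; [|exact: same_refl|by []].
  split=> [/orP[->|gs]|[->//|[h _ gh]]]; [by left|by right; exists (hd s)|].
  by rewrite (gE _ h) ?gh ?orbT.
case/andP=> vvs uvs /andP[vc cvs]; rewrite inE negb_or => /andP[rv rvs] gE body.
have vt : ~~ touches (loops vs c) v by rewrite touches_loops negb_or vvs.
have [H1 H2] : (0 < hd (exec (for_ v (loops vs c)) s) r -> 0 < hd s r \/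
     exists2 h, {in vs, forall w, h w < L} & (h v < L) && g h) /\
   (0 < hd s r \/ (exists2 h, {in vs, forall w, h w < L} & (h v < L) && g h) ->
     0 < hd (exec (for_ v (loops vs c)) s) r).
  apply: (for_ind (I := fun n s1 => (0 < hd s1 r -> 0 < hd s r \/
     exists2 h, {in vs, forall w, h w < L} & (h v < n) && g h) /\
    (0 < hd s r \/ (exists2 h, {in vs, forall w, h w < L} & (h v < n) && g h) -> 0 < hd s1 r))) => //.
    rewrite /= /upd (negPf rv); split; first by left.
    by case=> // -[].
  move=> i s1 iL vi ss1 [I1 I2] /=; rewrite /upd (negPf rv).
  have [||||s2 ss2 s2L|J1 J2] := IH (fun h => g (upd v i h)) s1 => //.
  - move=> h h' hh; apply: gE => w; rewrite inE /upd; case: eqP => //= _; exact: hh.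
  - have vi2 : hd s2 v = i by rewrite ss2.1.
    rewrite body.
    + congr orb; apply: gE => w _; rewrite /upd; case: eqP => // ->; exact: vi2.
    + apply: (@same_trans _ _ _ s1).
        by apply: same_sub ss1 => x //; rewrite writes_for writes_loops.
      by apply: same_sub ss2 => x //= ->; rewrite orbT.
    + by move=> w; rewrite inE => /orP[/eqP->|/s2L//]; rewrite vi2.
  split=> [/J1[/I1[|[h hL /andP[hi gh]]]|[h hL gh]]|].
  - by left.
  - by right; exists h => //; rewrite gh andbT ltnS ltnW.
  - right; exists (upd v i h); last by rewrite gh /upd eqxx ltnS leqnn.
    by move=> w wvs; rewrite /upd; case: eqP => // _; apply: hL.
  - case=> [s0|[h hL /andP[hi gh]]]; first by apply: J2; left; apply: I2; left.
    apply: J2; move: hi; rewrite ltnS leq_eqVlt => /orP[/eqP hi|hi].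
      right; exists h => //; rewrite (gE _ h) // => w _; rewrite /upd; by case: eqP => // ->.
    by left; apply: I2; right; exists h; rewrite ?hi.
split=> [/H1[|[h hL /andP[hv gh]]]|[s0|[h hL gh]]]; [by left| | |].
- by right; exists h => // w; rewrite inE => /orP[/eqP->|/hL].
- by apply: H2; left.
- apply: H2; right; exists h; first by move=> w wvs; apply: hL; rewrite inE wvs orbT.
  by rewrite gh andbT hL // inE eqxx.
Qed.

Lemma exec_skip s : exec (Skip V A) s = s. Proof. by []. Qed.
Lemma exec_zero v s : exec (Zero A v) s = St (upd v 0 (hd s)) (ar s). Proof. by []. Qed.
Lemma exec_inc v s : exec (Inc A v) s = St (upd v (hd s v).+1 (hd s)) (ar s).
Proof. by []. Qed.
Lemma exec_put a v b s :
  exec (Put a v b) s = St (hd s) (upd a (upd (hd s v) b (ar s a)) (ar s)).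
Proof. by []. Qed.
Lemma exec_seq c1 c2 s : exec (Seq c1 c2) s = exec c2 (exec c1 s). Proof. by []. Qed.
Lemma exec_if b c1 c2 s :
  exec (If b c1 c2) s = if holds L (hd s) (ar s) b then exec c1 s else exec c2 s.
Proof. by []. Qed.
Definition execE := (exec_skip, exec_zero, exec_inc, exec_put, exec_seq, exec_if).

Definition if_eq (v w : V) c1 c2 : cmd V A := If (Lt v w) c2 (If (Lt w v) c2 c1).

(** Two counters off the tape cannot be told apart, so one of them has to be below [L]. *)
Lemma exec_if_eq v w c1 c2 s : hd s v < L \/ hd s w < L ->
  exec (if_eq v w c1 c2) s = if hd s v == hd s w then exec c1 s else exec c2 s.
Proof.
by rewrite /=; case: (ltngtP (hd s v) (hd s w)) => //= h H; case: ltnP => //; lia.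
Qed.

End ProgramLogic.
Arguments exec : simpl never.
Arguments seqs : simpl never.
Arguments for_ : simpl never.
Arguments loops : simpl never.


(** * The decision program *)

Lemma sum_ltn m x : \sum_(i < m) (i < x) = minn m x.
Proof. by elim: m => [|m IH]; rewrite ?big_ord0 ?min0n // big_ord_recr /= IH; lia. Qed.

Lemma sum_card_ord m n (P : pred 'I_n) (f : nat -> nat) : n <= m ->
  (forall w : 'I_n, f w = P w) -> (forall w, n <= w -> f w = 0) ->
  \sum_(w < m) f w = #|[set w | P w]|.
Proof.
move=> nm fP f0; rewrite -(big_mkord xpredT) (@big_cat_nat _ _ _ n) //=.
rewrite [X in _ + X]big1_seq ?addn0; last first.
  by move=> w; rewrite mem_index_iota => /andP[_ /andP[nw _]]; apply: f0.
rewrite big_mkord -sum1_card [RHS]big_mkcond /=; apply: eq_bigr => w _.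
by rewrite fP inE; case: (P w).
Qed.

Section Program.
Variables (c : nat) (i0 : 'I_c).

(* Scalar variables, the bounds [a_j] and [b_j], and for each set [A] of colours
   the number of neighbours with list [A] and its splitting by chosen colours. *)
Definition var := ('I_14 + ('I_c + 'I_c) + ({set 'I_c} + {set 'I_c} * 'I_c))%type.

(* [None] is the adjacency matrix, [Some (j, b)] holds the pruned triples of
   colour [j] ([b = false]) and their next value ([b = true]). *)
Definition arr := option ('I_c * bool).

Definition scalar k (kP : k < 14) : var := inl (inl (Ordinal kP)).
Definition vP := @scalar 0 isT.
Definition vJ := @scalar 1 isT.
Definition vK := @scalar 2 isT.
Definition vW := @scalar 3 isT.
Definition vF := @scalar 4 isT.
Definition vOk := @scalar 5 isT.
Definition vAcc := @scalar 6 isT.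
Definition vN := @scalar 7 isT.
Definition vU := @scalar 8 isT.
Definition vV := @scalar 9 isT.
Definition vZ := @scalar 10 isT.
Definition vR := @scalar 11 isT.
Definition vQ := @scalar 12 isT.
Definition vI := @scalar 13 isT.
Definition vA j : var := inl (inr (inl j)).
Definition vB j : var := inl (inr (inr j)).
Definition vT (A : {set 'I_c}) : var := inr (inl A).
Definition vX (A : {set 'I_c}) j : var := inr (inr (A, j)).

Definition scratch (v : var) : bool :=
  match v with
  | inl (inl k) => k < 7
  | inl (inr _) => false
  | inr _ => true
  end.

Notation cmd := (cmd var arr).
Notation st := (st var arr).
Notation Skip := (@Skip var arr).
Notation Zero := (@Zero var arr).
Notation Inc := (@Inc var arr).
Notation "c1 ;; c2" := (Seq c1 c2) (at level 60, right associativity).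

Definition add_to (acc x : var) : cmd := for_ vK (If (Lt vK x) (Inc acc) Skip).

Definition addr (x y : var) : cmd :=
  Zero vP ;; for_ vJ (If (Lt vJ x) (add_to vP vN) Skip) ;; add_to vP y.

(* The tape length is [n ^ 2]; [find_n] increments [vN] while its square is smaller. *)
Definition find_n : cmd :=
  Zero vN ;;
  for_ vI (Zero vP ;; for_ vJ (If (Lt vJ vN) (add_to vP vN) Skip) ;;
           If (On vP) (Inc vN) Skip).

(** The arrays hold the pruned colours, so membership of [j] in [A] is matched with a cleared bit at
    [vP]. *)
Definition if_list (A : {set 'I_c}) (l : seq 'I_c) (yes : cmd) : cmd :=
  foldr (fun j k => if j \in A then If (Bit (Some (j, false)) vP) Skip k
                    else If (Bit (Some (j, false)) vP) k Skip) yes l.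

Definition count_at (i : 'I_c) : cmd :=
  if_eq vW vV (Inc (vT [set i]))
    (seqs [seq if_list A (enum 'I_c) (Inc (vT A)) | A <- enum {set 'I_c}]).

(** The address is that of [(w, u)], because the list of [w] as a neighbour of [u] is read from the
    triples [(j, w, u)]; the adjacency bit found there is right by symmetry. *)
Definition count_types (i : 'I_c) : cmd :=
  seqs [seq Zero (vT A) | A <- enum {set 'I_c}] ;;
  for_ vW (If (Lt vW vN) (addr vW vU ;; If (Bit None vP) (count_at i) Skip) Skip).

Definition check_type (A : {set 'I_c}) : cmd :=
  Zero vAcc ;; seqs [seq add_to vAcc (vX A j) | j <- enum A] ;;
  if_eq vAcc (vT A) Skip (Zero vOk).

Definition check_degree (j : 'I_c) : cmd :=
  Zero vAcc ;;
  seqs [seq add_to vAcc (vX A j) | A <- enum [set A : {set 'I_c} | j \in A]] ;;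
  If (Lt vZ vAcc) (if_eq vAcc (vA j) Skip (if_eq vAcc (vB j) Skip (Zero vOk))) Skip.

Definition check_split : cmd :=
  Zero vOk ;; Inc vOk ;;
  seqs [seq check_type A | A <- enum {set 'I_c}] ;;
  seqs [seq check_degree j | j <- enum 'I_c] ;;
  If (Lt vZ vOk) (Inc vF) Skip.

Definition split_vars : seq var :=
  [seq vX p.1 p.2 | p <- enum {: {set 'I_c} * 'I_c}].

Definition feas (i : 'I_c) : cmd :=
  Zero vF ;; count_types i ;; loops split_vars check_split.

(** The result goes to the arrays of next values: all tests of a round must read the same set, so
    that a round is exactly one application of [prune]. *)
Definition prune_at (i : 'I_c) : cmd :=
  feas i ;; addr vU vV ;;
  If (Lt vZ vF) (Put (Some (i, true)) vP false) (Put (Some (i, true)) vP true).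

Definition prune_all : cmd :=
  for_ vU (If (Lt vU vN)
    (for_ vV (If (Lt vV vN) (seqs [seq prune_at i | i <- enum 'I_c]) Skip)) Skip).

Definition copy_at (i : 'I_c) : cmd :=
  If (Bit (Some (i, true)) vQ) (Put (Some (i, false)) vQ true) (Put (Some (i, false)) vQ false).

Definition round : cmd :=
  prune_all ;; for_ vQ (seqs [seq copy_at i | i <- enum 'I_c]).

(** Trials for successive bounds share the arrays, so each has to start by restoring the empty
    set. *)
Definition clear : cmd :=
  for_ vQ (seqs [seq Put (Some (i, false)) vQ false | i <- enum 'I_c]).

(** [Rep round] makes [n * n] rounds; one copy per colour makes [c * n * n], the number of
    iterations in [fixset]. Then [vV] receives [n], which is no vertex, so the local problem at
    vertex 0 is solved with no edge pinned. *)
Definition trial : cmd :=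
  clear ;; seqs [seq Rep round | i <- enum 'I_c] ;;
  Zero vU ;; Zero vV ;; add_to vV vN ;; feas i0 ;; If (Lt vZ vF) (Inc vR) Skip.

Definition bound_vars : seq var := [seq vA j | j <- enum 'I_c] ++ [seq vB j | j <- enum 'I_c].

Definition decide : cmd := Zero vZ ;; find_n ;; Zero vR ;; loops bound_vars trial.

Lemma addr_touches x y v : touches (addr x y) v -> v \in [:: vP; vJ; vK].
Proof. by move=> /=; repeat (first [done | move/eqP-> | case/orP]). Qed.


(** * Correctness of the program on an adjacency matrix *)

Section Correctness.
Variables (n : nat) (n_gt0 : 0 < n) (e : rel 'I_n).
Hypothesis e_irr : forall x, e x x = false.
Notation L := (n * n).
Notation exec := (exec L).

Lemma leqnL : n <= L.
Proof. by rewrite leq_pmull. Qed.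

Lemma pos_lt (u v : 'I_n) : u * n + v < L.
Proof.
apply: (@leq_trans (u.+1 * n)); first by rewrite mulSn addnC ltn_add2r.
by rewrite leq_mul2r ltn_ord orbT.
Qed.

Lemma pos_inj (u v u' v' : 'I_n) : u * n + v = u' * n + v' -> u = u' /\ v = v'.
Proof.
move=> E; have Eu : u = u' :> nat.
  by have := congr1 (fun x => x %/ n) E; rewrite !divnMDl // !divn_small // !addn0.
by split; apply/val_inj => //; move: E; rewrite Eu => /addnI.
Qed.

Lemma add_to_spec acc x s : acc != vK -> x != vK -> x != acc ->
  hd (exec (add_to acc x) s) acc = hd s acc + minn L (hd s x).
Proof.
move=> aK xK xa; rewrite /add_to (for_sum (f := fun i => (i < hd s x : nat))) ?sum_ltn //=.
  by rewrite eq_sym orbF.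
move=> i s1 iL iK ss1; rewrite -(ss1.1 x); last by rewrite /= !negb_or xK xa.
by rewrite execE /= iK iL andbT; case: ifP => _; rewrite execE /= /upd ?eqxx ?addn1 ?addn0.
Qed.

Lemma mul_spec x s : x \notin [:: vP; vJ; vK] -> hd s x <= L -> hd s vN <= L ->
  hd (exec (for_ vJ (If (Lt vJ x) (add_to vP vN) Skip)) s) vP =
  hd s vP + hd s x * hd s vN.
Proof.
rewrite !inE !negb_or => /and3P[xP xJ xK] xL NL.
rewrite (for_sum (f := fun i => (i < hd s x : nat) * hd s vN)) //.
  by rewrite -big_distrl /= sum_ltn (minn_idPr xL).
move=> i s1 iL iJ ss1; rewrite execE /= iJ (ss1.1 x) ?iL ?andbT; last first.
  by rewrite /= !negb_or xP xJ xK.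
case: ifP => _; last by rewrite addn0.
by rewrite add_to_spec // (ss1.1 vN) // mul1n (minn_idPr NL).
Qed.

Lemma addr_spec x y s : x \notin [:: vP; vJ; vK] -> y \notin [:: vP; vJ; vK] ->
  hd s x <= L -> hd s y <= L -> hd s vN = n ->
  hd (exec (addr x y) s) vP = hd s x * n + hd s y.
Proof.
move=> xn yn xL yL sN; move: (xn) (yn); rewrite !inE !negb_or => /and3P[xP _ _] /and3P[yP yJ yK].
rewrite /addr 2!exec_seq exec_zero add_to_spec // [X in minn _ X]frame_hd; last first.
  by rewrite /= !negb_or yP yJ yK.
by rewrite mul_spec //= /upd ?(negPf yP) ?(negPf xP) ?sN ?leqnL // (minn_idPr yL).
Qed.

Lemma find_n_spec s : hd (exec find_n s) vN = n.
Proof.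
rewrite /find_n exec_seq -[RHS](minn_idPr leqnL).
apply: (for_ind (I := fun k s1 => hd s1 vN = minn k n)) => //.
  by rewrite /= min0n.
move=> i s1 iL iI ss1; move Em: (minn i n) => m sN.
have mn : m <= n by rewrite -Em geq_minr.
have mL : m <= L by apply: leq_trans mn leqnL.
rewrite 2!exec_seq exec_zero; set s2 := exec _ (St _ _).
have s2N : hd s2 vN = m by rewrite /s2 frame_hd.
have s2P : hd s2 vP = m * m by rewrite /s2 mul_spec //= /upd /= ?sN.
rewrite exec_if /= s2P /upd /=.
have -> : (m * m < L) = (m < n).
  apply/idP/idP => [|mn']; last by rewrite ltn_mul.
  by apply: contraTT; rewrite -!leqNgt => nm; rewrite leq_mul.
by case: ifP => mn'; rewrite execE /= /upd /= ?s2N; lia.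
Qed.

Hypothesis e_sym : forall x y, e x y = e y x.

Definition adj_ok (s : st) := forall u v : 'I_n, ar s None (u * n + v) = e u v.

Definition pruned_ok (s : st) (X : {set 'I_c * 'I_n * 'I_n}) :=
  forall i (u v : 'I_n), ar s (Some (i, false)) (u * n + v) = ((i, u, v) \in X).

Lemma if_list_touches A l yes v : touches (if_list A l yes) v -> touches yes v.
Proof. by elim: l => //= j l IH; case: ifP => _ /=; rewrite ?orbF. Qed.

Lemma if_list_writes A l yes a : writes (if_list A l yes) a -> writes yes a.
Proof. by elim: l => //= j l IH; case: ifP => _ /=; rewrite ?orbF. Qed.

Lemma if_list_spec A l yes s X (u w : 'I_n) : hd s vP = w * n + u -> pruned_ok s X ->
  exec (if_list A l yes) s =
  if all (fun j => (j \in A) == (j \in unpruned X u w)) l then exec yes s else s.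
Proof.
move=> sP sX; elim: l => //= j l IH; rewrite inE -sX.
case: ifP => _; rewrite exec_if /= sP pos_lt /=; case: (ar s _ _) => //=.
Qed.

(** [pinned] with a number [v], which may be [n]; then no neighbour is pinned. *)
Definition counted X i u (v : nat) (w : 'I_n) : {set 'I_c} :=
  if w == v :> nat then [set i] else unpruned X u w.

Definition counter (v : var) : bool := if v is inr _ then true else false.

Lemma count_at_touches i v : touches (count_at i) v -> counter v.
Proof.
rewrite /count_at /= orbA orbb touches_map => /orP[/hasP[A _]|/eqP->//].
by move/if_list_touches/eqP->.
Qed.

Lemma count_at_writes i a : writes (count_at i) a = false.
Proof.
by rewrite /count_at /= orbF orbb writes_map; apply/hasP => -[A _] /if_list_writes.
Qed.

Lemma count_at_spec i A s X (u w : 'I_n) :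
  hd s vP = w * n + u -> hd s vW = w -> pruned_ok s X ->
  hd (exec (count_at i) s) (vT A) = hd s (vT A) + (counted X i u (hd s vV) w == A).
Proof.
move=> sP sW sX; have wL : w < L by apply: leq_trans leqnL.
rewrite /count_at exec_if_eq sW ?wL; last by left.
rewrite /counted; case: eqP => [wv|_].
  rewrite exec_inc /= /upd; case: eqP => [[->]|ne]; first by rewrite eqxx addn1.
  by case: eqP => [E|_]; [case: ne; rewrite E|rewrite addn0].
rewrite (seqs_sum (g := fun A' => (A' == A) && (unpruned X u w == A'))).
  rewrite big_enum /= (bigD1 A) //= eqxx big1 ?addn0 // => A' /negPf -> //.
move=> A' s1 _ ss1; rewrite (@if_list_spec _ _ _ _ X u w); last first.
- move=> j x y; rewrite (ss1.2 (Some (j, false))) //.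
  by rewrite writes_map; apply/hasP => -[A1 _] /if_list_writes.
- by rewrite (ss1.1 vP) // touches_map; apply/hasP => -[A1 _] /if_list_touches.
have -> : all (fun j => (j \in A') == (j \in unpruned X u w)) (enum 'I_c) = (unpruned X u w == A').
  apply/allP/eqP => [H|->//]; apply/setP => j.
  by apply/esym/eqP/H; rewrite mem_enum.
case: (unpruned X u w == A'); rewrite ?andbF ?addn0 // andbT execE /= /upd.
by case: (eqVneq A' A) => [->|ne]; rewrite ?eqxx ?addn1 // ?addn0; case: eqP => // -[E]; rewrite E eqxx in ne.
Qed.

Lemma count_types_touches i v : touches (count_types i) v -> scratch v.
Proof.
rewrite /count_types touches_seq touches_map => /orP[/hasP[A _ /eqP->//]|].
rewrite touches_for touches_if touches_seq touches_if.
case/orP => [/eqP->//|/orP[/orP[/addr_touches|/orP[/count_at_touches|]]|]] //; last by case: v.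
by rewrite !inE => /or3P[] /eqP->.
Qed.

Lemma count_types_writes i a : writes (count_types i) a = false.
Proof.
rewrite /count_types writes_seq writes_for writes_if writes_seq writes_if count_at_writes.
by rewrite writes_map (eq_has (a2 := pred0)) // has_pred0.
Qed.

Lemma count_types_spec i A s X (u : 'I_n) :
  hd s vN = n -> hd s vU = u -> adj_ok s -> pruned_ok s X ->
  hd (exec (count_types i) s) (vT A) =
    #|[set w | e u w && (counted X i u (hd s vV) w == A)]|.
Proof.
move=> sN sU sa sX; rewrite /count_types exec_seq; set s0 := exec _ s.
have ss0 : same counter pred0 s s0.
  split=> [v vn|a _]; rewrite /s0; [apply: frame_hd|apply: frame_ar].
    by rewrite touches_map; apply/hasP => -[A' _] /= /eqP E; rewrite E in vn.
  by rewrite writes_map; apply/hasP => -[].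
have s0T : hd s0 (vT A) = 0.
  pose I (l1 : seq {set 'I_c}) (s1 : st) := hd s1 (vT A) = 0 \/ A \notin l1.
  have : I (enum {set 'I_c}) s0; last by rewrite /I mem_enum => -[].
  apply: seqs_ind; first by right.
  move=> A' l1 s1 _ _ I1; rewrite /I exec_zero /= /upd mem_rcons inE negb_or.
  case: eqP => [_|ne]; first by left.
  by case: I1 => [->|->]; [left|right; rewrite andbT; apply/eqP => E; case: ne; rewrite E].
pose P (w : 'I_n) := e u w && (counted X i u (hd s vV) w == A).
(* The loop runs up to [n * n]; indices that are not vertices contribute 0. *)
pose f w : nat := if insub w is Some w' then P w' else false.
rewrite (for_sum (f := f)) //.
- rewrite s0T add0n; apply: (@sum_card_ord _ _ P f); first exact: leqnL.
    by move=> w; rewrite /f valK.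
  by move=> w nw; rewrite /f insubF // ltnNge nw.
- apply/negP; rewrite touches_if touches_seq touches_if.
  by case/orP => [/orP[/addr_touches|/orP[/count_at_touches|]]|].
move=> w s1 wL sW ss1.
have ss : same (touches (count_types i)) (writes (count_types i)) s s1.
  apply: (@same_trans _ _ _ _ _ s0).
    by apply: same_sub (same_exec _ _ _) => x; rewrite ?touches_seq ?writes_seq => ->.
  by apply: same_sub ss1 => x; rewrite ?touches_seq ?writes_seq => ->; rewrite orbT.
have nt v : ~~ scratch v -> hd s1 v = hd s v.
  by move=> vn; apply: ss.1; apply: contra vn; apply: count_types_touches.
have na a : ar s1 a = ar s a by apply: ss.2; rewrite count_types_writes.
have s1a : adj_ok s1 by move=> x y; rewrite na.
have s1X : pruned_ok s1 X by move=> j x y; rewrite na.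
rewrite exec_if /= sW (nt vN) // sN wL andbT.
rewrite /f /P; case: insubP => [w' wn w'w|/negPf ->]; last by rewrite execE addn0.
rewrite wn exec_seq exec_if.
have aP : hd (exec (addr vW vU) s1) vP = w' * n + u.
  by rewrite addr_spec // ?sW ?(nt vU) ?sU ?(nt vN) // ?w'w // ltnW // (leq_trans _ leqnL).
rewrite [holds _ _ _ _]/= aP pos_lt /= frame_ar // s1a e_sym.
case: (e u w') => /=; last by rewrite execE addn0 frame_hd.
rewrite (@count_at_spec _ _ _ X u w') //.
- by rewrite !frame_hd // (nt vV).
- by rewrite frame_hd // sW w'w.
- by move=> j x y; rewrite frame_ar // s1X.
Qed.

Lemma add_all_spec (T : eqType) (x : T -> var) l s :
  (forall t, counter (x t)) -> (forall t, hd s (x t) < L) ->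
  hd (exec (seqs [seq add_to vAcc (x t) | t <- l]) s) vAcc =
  hd s vAcc + \sum_(t <- l) hd s (x t).
Proof.
move=> xc xL.
have nx t v : counter v -> ~~ touches (add_to vAcc (x t)) v by case: v.
apply: seqs_sum => t s1 _ ss1; have xct := xc t; have xtL := xL t.
rewrite add_to_spec; [|by []|by case: (x t) xct|by case: (x t) xct].
rewrite (ss1.1 (x t)) ?(minn_idPr (ltnW xtL)) // touches_map; apply/hasPn => t' _; exact: nx.
Qed.

Lemma add_all_touches (T : eqType) (x : T -> var) l v :
  touches (seqs [seq add_to vAcc (x t) | t <- l]) v -> v \in [:: vAcc; vK; vOk].
Proof. by rewrite touches_map => /hasP[t _] /=; rewrite orbF => /or3P[] /eqP->. Qed.

Lemma add_all_writes (T : eqType) (x : T -> var) l a :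
  writes (seqs [seq add_to vAcc (x t) | t <- l]) a = false.
Proof. by rewrite writes_map (eq_has (a2 := pred0)) // has_pred0. Qed.

Lemma check_type_touches A v : touches (check_type A) v -> v \in [:: vAcc; vK; vOk].
Proof.
rewrite /check_type 2!touches_seq => /or3P[/eqP->//|/add_all_touches//|].
by rewrite /= orbF orbb => /eqP->.
Qed.

Lemma check_degree_touches j v : touches (check_degree j) v -> v \in [:: vAcc; vK; vOk].
Proof.
rewrite /check_degree 2!touches_seq => /or3P[/eqP->//|/add_all_touches//|].
by rewrite /= !orbF !orbb => /eqP->.
Qed.

Lemma check_type_spec A s : (forall j, hd s (vX A j) < L) -> hd s (vT A) < L ->
  (0 < hd (exec (check_type A) s) vOk) =
  (0 < hd s vOk) && (\sum_(j in A) hd s (vX A j) == hd s (vT A)).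
Proof.
move=> xL tL; rewrite /check_type 2!exec_seq exec_zero; set s1 := exec _ (St _ _).
have s1acc : hd s1 vAcc = \sum_(j in A) hd s (vX A j).
  by rewrite /s1 add_all_spec //= big_enum.
have s1E v : v \notin [:: vAcc; vK; vOk] -> hd s1 v = hd s v.
  move=> vn; rewrite /s1 frame_hd; last by apply: contra vn; apply: add_all_touches.
  by rewrite /= /upd; case: eqP vn => [->|].
have s1ok : hd s1 vOk = hd s vOk.
  by rewrite /s1 frame_hd // touches_map; apply/hasPn => t _.
rewrite exec_if_eq ?(s1E (vT A)) ?tL //; last by right.
rewrite s1acc; case: eqP => _; rewrite ?exec_skip ?andbT ?s1ok // exec_zero andbF.
by [].
Qed.

Lemma check_degree_spec j s : hd s vZ = 0 -> (forall A, hd s (vX A j) < L) ->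
  hd s (vA j) < L -> hd s (vB j) < L ->
  (0 < hd (exec (check_degree j) s) vOk) =
  (0 < hd s vOk) &&
  allowed (hd s (vA j)) (hd s (vB j)) (\sum_(A : {set 'I_c} | j \in A) hd s (vX A j)).
Proof.
move=> sZ xL aL bL; rewrite /check_degree 2!exec_seq exec_zero; set s1 := exec _ (St _ _).
have s1acc : hd s1 vAcc = \sum_(A : {set 'I_c} | j \in A) hd s (vX A j).
  by rewrite /s1 add_all_spec //= big_enum; apply: eq_bigl => A; rewrite inE.
have s1E v : v \notin [:: vAcc; vK; vOk] -> hd s1 v = hd s v.
  move=> vn; rewrite /s1 frame_hd; last by apply: contra vn; apply: add_all_touches.
  by rewrite /= /upd; case: eqP vn => [->|].
have s1ok : hd s1 vOk = hd s vOk.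
  by rewrite /s1 frame_hd // touches_map; apply/hasPn => t _.
have L0 : 0 < L by rewrite muln_gt0 n_gt0.
rewrite exec_if /= s1E // sZ L0 andbT /allowed s1acc.
case: (posnP (\sum_(A | _) _)) => [_|S0] /=; first by rewrite exec_skip s1ok andbT.
rewrite exec_if_eq ?(s1E (vA j)) ?aL //; last by right.
rewrite s1acc; case: eqP => [_|_]; first by rewrite exec_skip s1ok andbT.
rewrite exec_if_eq ?(s1E (vB j)) ?bL //; last by right.
rewrite s1acc; case: eqP => [_|_]; first by rewrite exec_skip s1ok andbT.
by rewrite exec_zero /= andbF.
Qed.

Definition split_ok (t : {set 'I_c} -> nat) (a b : 'I_c -> nat) (h : var -> nat) : bool :=
  [forall A : {set 'I_c}, \sum_(j in A) h (vX A j) == t A] &&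
  [forall j, allowed (a j) (b j) (\sum_(A : {set 'I_c} | j \in A) h (vX A j))].

Lemma check_split_touches v : touches check_split v -> v \in [:: vF; vAcc; vK; vOk].
Proof.
rewrite /check_split 4!touches_seq => /orP[/eqP->//|/orP[/eqP->//|/or3P[]]].
- by rewrite touches_map => /hasP[A _ /check_type_touches]; rewrite !inE => ->; rewrite orbT.
- by rewrite touches_map => /hasP[A _ /check_degree_touches]; rewrite !inE => ->; rewrite orbT.
- by rewrite /= orbF => /eqP->.
Qed.

Lemma check_split_writes a : writes check_split a = false.
Proof.
rewrite /check_split 4!writes_seq !writes_map !(eq_has (a2 := pred0)) ?has_pred0 //.
- by move=> j; rewrite /check_degree 2!writes_seq add_all_writes.
- by move=> A; rewrite /check_type 2!writes_seq add_all_writes.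
Qed.

Lemma check_split_spec s : hd s vZ = 0 -> (forall A j, hd s (vX A j) < L) ->
  (forall A, hd s (vT A) < L) -> (forall j, hd s (vA j) < L) -> (forall j, hd s (vB j) < L) ->
  (0 < hd (exec check_split s) vF) =
  (0 < hd s vF) || split_ok (fun A => hd s (vT A)) (fun j => hd s (vA j)) (fun j => hd s (vB j)) (hd s).
Proof.
move=> sZ xL tL aL bL; rewrite /check_split 4!exec_seq exec_zero exec_inc.
set s0 := St _ _; set s1 := exec _ s0; set s2 := exec _ s1.
have s0E v : v != vOk -> hd s0 v = hd s v by move=> /negPf vn; rewrite /s0 /= /upd vn.
have ss1 : same (mem [:: vAcc; vK; vOk]) predT s0 s1.
  apply: same_sub (same_exec _ _ _) => // v.
  by rewrite touches_map => /hasP[A _ /check_type_touches].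
have ss2 : same (mem [:: vAcc; vK; vOk]) predT s1 s2.
  apply: same_sub (same_exec _ _ _) => // v.
  by rewrite touches_map => /hasP[A _ /check_degree_touches].
have s1E v : v \notin [:: vAcc; vK; vOk] -> hd s1 v = hd s v.
  move=> vn; rewrite ss1.1 // s0E //; apply: contra vn => /eqP->; by [].
have s1ok : (0 < hd s1 vOk) = [forall A : {set 'I_c}, \sum_(j in A) hd s (vX A j) == hd s (vT A)].
  rewrite /s1 (seqs_all (P := fun A : {set 'I_c} => \sum_(j in A) hd s (vX A j) == hd s (vT A))).
    rewrite {1}/s0 /= /upd /=; apply/allP/forallP => [H A|H A _]; last exact: H.
    by apply: H; rewrite mem_enum.
  move=> A s3 _ ss3; have s3E v : v \notin [:: vAcc; vK; vOk] -> hd s3 v = hd s v.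
    move=> vn; rewrite ss3.1.
      by rewrite s0E //; apply: contra vn => /eqP->.
    by apply: contra vn; rewrite touches_map => /hasP[A' _ /check_type_touches].
  rewrite check_type_spec ?(s3E (vT A)) ?tL //; last by move=> j; rewrite s3E.
  by rewrite (eq_bigr (fun j => hd s (vX A j))) // => j _; rewrite s3E.
have s2ok : (0 < hd s2 vOk) = split_ok (fun A => hd s (vT A)) (fun j => hd s (vA j)) (fun j => hd s (vB j)) (hd s).
  rewrite /s2 (seqs_all (P := fun j => allowed (hd s (vA j)) (hd s (vB j)) (\sum_(A : {set 'I_c} | j \in A) hd s (vX A j)))).
    rewrite s1ok; congr andb; apply/allP/forallP => [H j|H j _]; last exact: H.
    by apply: H; rewrite mem_enum.
  move=> j s3 _ ss3; have s3E v : v \notin [:: vAcc; vK; vOk] -> hd s3 v = hd s v.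
    move=> vn; rewrite ss3.1; first exact: s1E.
    by apply: contra vn; rewrite touches_map => /hasP[A' _ /check_degree_touches].
  rewrite check_degree_spec ?(s3E (vA j)) ?(s3E (vB j)) ?(s3E vZ) ?aL ?bL //.
    by rewrite (eq_bigr (fun A => hd s (vX A j))) // => A _; rewrite s3E.
  by move=> A; rewrite s3E.
have L0 : 0 < L by rewrite muln_gt0 n_gt0.
have s2F : hd s2 vF = hd s vF by rewrite ss2.1 // s1E.
rewrite exec_if /= ss2.1 // s1E // sZ L0 andbT -s2ok.
by case: ifP => _; rewrite execE ?s2F /= ?s2F ?orbT ?orbF // /upd /=.
Qed.

Lemma split_vars_counter v : v \in split_vars -> counter v.
Proof. by case/mapP => p _ ->. Qed.

Lemma vX_split A j : vX A j \in split_vars.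
Proof. by apply/mapP; exists (A, j); rewrite ?mem_enum. Qed.

Lemma feas_touches i v : touches (feas i) v -> scratch v.
Proof.
rewrite /feas 2!touches_seq => /or3P[/eqP->//|/count_types_touches//|].
rewrite touches_loops => /orP[/split_vars_counter|/check_split_touches]; first by case: v.
by rewrite !inE => /or4P[] /eqP->.
Qed.

Lemma feas_writes i a : writes (feas i) a = false.
Proof. by rewrite /feas 2!writes_seq count_types_writes writes_loops check_split_writes. Qed.

(** The search raises [vF] iff some splitting passes the check, and [feasible_counts] turns
    splittings into solutions of the local problem. Degrees are below [n], hence counters below [L]
    are enough. *)
Lemma feas_spec i s X (u : 'I_n) : hd s vZ = 0 -> hd s vN = n -> hd s vU = u ->
  adj_ok s -> pruned_ok s X -> (forall j, hd s (vA j) < L) -> (forall j, hd s (vB j) < L) ->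
  (0 < hd (exec (feas i) s) vF) =
  feasible e (fun j => hd s (vA j)) (fun j => hd s (vB j)) u (counted X i u (hd s vV)).
Proof.
move=> sZ sN sU sa sX aL bL; rewrite /feas 2!exec_seq exec_zero.
set s0 := St _ _; set s1 := exec _ s0.
have degL : #|[set w | e u w]| < L.
  apply: leq_trans leqnL; rewrite -[X in _ < X]card_ord -cardsT; apply: proper_card.
  by rewrite properT; apply/eqP => /setP/(_ u); rewrite !inE e_irr.
pose t A := #|[set w | e u w && (counted X i u (hd s vV) w == A)]|.
have s1T A : hd s1 (vT A) = t A by rewrite /s1 (@count_types_spec _ _ _ X u).
have s1E v : ~~ scratch v -> hd s1 v = hd s v.
  move=> vn; rewrite /s1 frame_hd; last by apply: contra vn; apply: count_types_touches.
  by rewrite /= /upd; case: eqP vn => [->|].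
have s1F : hd s1 vF = 0.
  rewrite /s1 frame_hd // /count_types touches_seq touches_map negb_or; apply/andP; split.
    by apply/hasPn => A _.
  rewrite touches_for touches_if touches_seq touches_if; apply/negP.
  by case/orP => [//|/orP[/orP[/addr_touches|/orP[/count_at_touches|]]|]].
have tL A : t A < L.
  by apply: leq_ltn_trans degL; apply/subset_leq_card/subsetP => w; rewrite !inE => /andP[].
set a := fun j => hd s (vA j); set b := fun j => hd s (vB j).
have [||||s2 ss2 s2L|H1 H2] := @loops_exists _ _ L split_vars check_split vF (split_ok t a b) s1.
- by rewrite map_inj_uniq ?enum_uniq // => -[A j] [A' j'] [-> ->].
- apply/allP => v /split_vars_counter vc; apply/negP => /check_split_touches.
  by rewrite !inE; case: v vc => // v _ /or4P[].
- by apply/negP => /split_vars_counter.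
- move=> h h' hh; rewrite /split_ok; congr andb; apply: eq_forallb => x.
    by congr eq_op; apply: eq_bigr => j _; apply: hh; apply: vX_split.
  by congr allowed; apply: eq_bigr => j _; apply: hh; apply: vX_split.
- have s2E v : v \notin split_vars -> ~~ (v \in [:: vF; vAcc; vK; vOk]) -> hd s2 v = hd s1 v.
    move=> vn vn'; apply: ss2.1; rewrite touches_loops negb_or vn.
    by apply: contra vn'; apply: check_split_touches.
  have nv k (kP : k < 14) : @scalar k kP \notin split_vars by apply/negP => /split_vars_counter.
  have nA j : vA j \notin split_vars by apply/negP => /split_vars_counter.
  have nB j : vB j \notin split_vars by apply/negP => /split_vars_counter.
  have nT A : vT A \notin split_vars by apply/mapP => -[].
  have e1 A : hd s2 (vT A) = t A by rewrite s2E.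
  have e2 j : hd s2 (vA j) = a j by rewrite s2E // s1E.
  have e3 j : hd s2 (vB j) = b j by rewrite s2E // s1E.
  rewrite check_split_spec.
  + congr orb; rewrite /split_ok; congr andb; apply: eq_forallb => x; first by rewrite e1.
    by rewrite e2 e3.
  + by rewrite (s2E vZ (nv 10 isT)) // s1E.
  + by move=> A j; apply: s2L; apply: vX_split.
  + by move=> A; rewrite e1.
  + by move=> j; rewrite e2; apply: aL.
  + by move=> j; rewrite e3; apply: bL.
have c0 : 0 < c by apply: leq_trans (ltn_ord i0).
have [F1 F2] := feasible_counts (e := e) (u := u) c0 a b (counted X i u (hd s vV)) degL.
apply/idP/idP => [/H1[|[h hL /andP[/forallP h1 /forallP h2]]]|/F1[x [xL x1 x2]]].
- by rewrite s1F.
- apply: F2; exists (fun A j => h (vX A j)); split=> // [A j|A]; last by apply/eqP; apply: h1.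
  by apply: hL; apply: vX_split.
apply: H2; right; exists (fun v => if v is inr (inr (A, j)) then x A j else 0).
  by move=> v /mapP[[A j] _ ->]; apply: xL.
apply/andP; split; apply/forallP => y; [by apply/eqP; apply: x1|exact: x2].
Qed.

Definition busy (v : var) : bool := scratch v || (v \in [:: vU; vV; vQ; vR]).

Definition ready (a b : 'I_c -> nat) (s : st) : Prop :=
  [/\ hd s vZ = 0, hd s vN = n, adj_ok s,
      forall j, hd s (vA j) = a j /\ a j < L & forall j, hd s (vB j) = b j /\ b j < L].

Lemma ready_same F G a b s s' : same F G s s' -> subpred F busy -> ~~ G None ->
  ready a b s -> ready a b s'.
Proof.
move=> [h g] Fb G0 [sZ sN sa sA sB].
have hE v : ~~ busy v -> hd s' v = hd s v by move=> vb; apply: h; apply: contra vb; apply: Fb.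
split; rewrite ?hE //.
- by move=> u v; rewrite g.
- by move=> j; rewrite hE.
- by move=> j; rewrite hE.
Qed.

Lemma ready_exec cm a b s : subpred (touches cm) busy -> ~~ writes cm None ->
  ready a b s -> ready a b (exec cm s).
Proof. exact: ready_same (same_exec _ _ _). Qed.

Lemma scratch_busy v : scratch v -> busy v.
Proof. by rewrite /busy => ->. Qed.

Lemma prune_at_touches i v : touches (prune_at i) v -> scratch v.
Proof.
rewrite /prune_at touches_seq [X in _ || X]touches_seq => /or3P[/feas_touches//|/addr_touches|//].
by rewrite !inE => /or3P[] /eqP->.
Qed.

Lemma prune_at_writes i a : writes (prune_at i) a -> a == Some (i, true).
Proof. by rewrite /prune_at writes_seq [X in _ || X]writes_seq feas_writes /= orbb. Qed.

Lemma prune_at_spec i a b s X (u v : 'I_n) : ready a b s -> pruned_ok s X ->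
  hd s vU = u -> hd s vV = v -> forall t q,
  ar (exec (prune_at i) s) t q =
    if (t == Some (i, true)) && (q == u * n + v) then (i, u, v) \in prune e a b X
    else ar s t q.
Proof.
move=> [sZ sN sa sA sB] sX sU sV t q; rewrite /prune_at 2!exec_seq.
set s1 := exec _ s; set s2 := exec _ s1.
have L0 : 0 < L by rewrite muln_gt0 n_gt0.
have s1E x : ~~ scratch x -> hd s1 x = hd s x.
  by move=> xn; apply: frame_hd; apply: contra xn; apply: feas_touches.
have s2Z : hd s2 vZ = 0 by rewrite /s2 frame_hd // s1E.
have s2P : hd s2 vP = u * n + v.
  by rewrite /s2 addr_spec ?s1E ?sU ?sV // ltnW // (leq_trans _ leqnL).
have s2F : (0 < hd s2 vF) = ((i, u, v) \notin prune e a b X).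
  rewrite /s2 frame_hd // /s1 (@feas_spec _ _ X u) //; last first.
  - by move=> j; case: (sB j) => ->.
  - by move=> j; case: (sA j) => ->.
  rewrite inE negbK /=.
  have -> : (fun j => hd s (vA j)) = a by apply/funext => j; case: (sA j).
  have -> : (fun j => hd s (vB j)) = b by apply/funext => j; case: (sB j).
  by rewrite /counted sV.
have s2A x : ar s2 x = ar s x by rewrite /s2 frame_ar // /s1 frame_ar // feas_writes.
rewrite exec_if /= s2Z L0 andbT s2F; case: ifPn => [/negPf pr|/negPn pr];
  by rewrite exec_put /= s2P /upd !s2A pr; case: eqP => [->|_] //=; case: eqP.
Qed.

Lemma prune_row_touches v : touches (seqs [seq prune_at i | i <- enum 'I_c]) v -> scratch v.
Proof. by rewrite touches_map => /hasP[i _ /prune_at_touches]. Qed.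

Lemma prune_row_writes a : writes (seqs [seq prune_at i | i <- enum 'I_c]) a ->
  exists i, a = Some (i, true).
Proof. by rewrite writes_map => /hasP[i _ /prune_at_writes/eqP->]; exists i. Qed.

Lemma prune_all_touches v : touches prune_all v -> scratch v || (v \in [:: vU; vV]).
Proof.
rewrite /prune_all touches_for touches_if touches_for touches_if !orbF.
case/or3P => [/eqP->//|/eqP->//|/prune_row_touches->//].
Qed.

Lemma prune_all_writes a : writes prune_all a -> exists i, a = Some (i, true).
Proof. by rewrite /prune_all writes_for writes_if writes_for writes_if !orbF => /prune_row_writes. Qed.

(** Fix one cell. Different pairs have different addresses, and every write is computed from the
    same unchanged [X]; so once the cell has its value, later writes cannot spoil it. *)
Lemma prune_all_spec i a b s X (u v : 'I_n) : ready a b s -> pruned_ok s X ->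
  ar (exec prune_all s) (Some (i, true)) (u * n + v) = ((i, u, v) \in prune e a b X).
Proof.
move=> sr sX.
pose good (s' : st) := ar s' (Some (i, true)) (u * n + v) = ((i, u, v) \in prune e a b X).
have gar s1 s2 : ar s1 = ar s2 -> good s1 -> good s2 by rewrite /good => ->.
have keep F G s1 s2 : same F G s1 s2 -> subpred F (fun x => scratch x || (x \in [:: vU; vV])) ->
    (forall x, G x -> exists j, x = Some (j, true)) ->
    ready a b s1 -> pruned_ok s1 X -> ready a b s2 /\ pruned_ok s2 X.
  move=> ss Fs Gs r1 X1; split.
    apply: ready_same ss _ _ r1; last by apply/negP => /Gs[].
    by move=> x /Fs /orP[/scratch_busy//|]; rewrite !inE => /orP[] /eqP->.
  by move=> j x y; rewrite ss.2 //; apply/negP => /Gs[].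
have keep1 cm s1 s2 : same (touches cm) (writes cm) s1 s2 ->
    subpred (touches cm) (touches prune_all) -> subpred (writes cm) (writes prune_all) ->
    ready a b s1 -> pruned_ok s1 X -> ready a b s2 /\ pruned_ok s2 X.
  by move=> ss ct cw; apply: keep ss _ _ => x; [move/ct/prune_all_touches|move/cw/prune_all_writes].
have rowt : subpred (touches (seqs [seq prune_at i | i <- enum 'I_c])) (touches prune_all).
  by move=> x xt; rewrite /prune_all touches_for touches_if touches_for touches_if xt !orbT.
have roww : subpred (writes (seqs [seq prune_at i | i <- enum 'I_c])) (writes prune_all).
  by move=> x xt; rewrite /prune_all writes_for writes_if writes_for writes_if xt.
have row s2 (x y : 'I_n) : ready a b s2 -> pruned_ok s2 X -> hd s2 vU = x -> hd s2 vV = y ->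
    good s2 \/ x = u /\ y = v -> good (exec (seqs [seq prune_at i | i <- enum 'I_c]) s2).
  move=> s2r s2X xU yV g2.
  have step j s3 : same (touches (seqs [seq prune_at i | i <- enum 'I_c]))
      (writes (seqs [seq prune_at i | i <- enum 'I_c])) s2 s3 ->
      good s3 \/ [/\ j = i, x = u & y = v] -> good (exec (prune_at j) s3).
    move=> ss3 g3; have [s3r s3X] := keep1 _ _ _ ss3 rowt roww s2r s2X.
    rewrite /good (@prune_at_spec j a b s3 X x y) //; last first.
    - by rewrite ss3.1 //; apply/negP => /prune_row_touches.
    - by rewrite ss3.1 //; apply/negP => /prune_row_touches.
    case: ifP => [/andP[/eqP[->] /eqP/pos_inj[-> ->]] //|].
    by case: g3 => // -[-> -> ->]; rewrite !eqxx.
  case: g2 => [g2|[xu yv]].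
    by apply: (seqs_ind (I := fun _ => good)) => // j _ s3 _ ss3 g3; apply: step => //; left.
  apply: (@seqs_reach _ _ _ _ _ good i); last by right; rewrite mem_enum.
  by move=> j s3 _ ss3 [g3|ji]; apply: step => //; [left|right].
have nVt : ~~ touches (If (Lt vV vN) (seqs [seq prune_at i | i <- enum 'I_c]) Skip) vV.
  by rewrite touches_if orbF; apply/negP => /prune_row_touches.
have col s1 (x : 'I_n) : ready a b s1 -> pruned_ok s1 X -> hd s1 vU = x ->
    good s1 \/ x = u ->
    good (exec (for_ vV (If (Lt vV vN) (seqs [seq prune_at i | i <- enum 'I_c]) Skip)) s1).
  move=> s1r s1X xU g1.
  have step y s2 : y < L -> hd s2 vV = y ->
      same (touches (for_ vV (If (Lt vV vN) (seqs [seq prune_at i | i <- enum 'I_c]) Skip)))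
        (writes (for_ vV (If (Lt vV vN) (seqs [seq prune_at i | i <- enum 'I_c]) Skip))) s1 s2 ->
      good s2 \/ x = u /\ y = v ->
      good (exec (If (Lt vV vN) (seqs [seq prune_at i | i <- enum 'I_c]) Skip) s2).
    move=> yL yV ss2 g2; have [||s2r s2X] := keep1 _ _ _ ss2 _ _ s1r s1X.
    - by move=> z zt; rewrite /prune_all touches_for touches_if zt orbT.
    - by move=> z zt; rewrite /prune_all writes_for writes_if zt.
    rewrite exec_if /= yV; case: (s2r) => [_ -> _ _ _]; rewrite yL andbT.
    case: ltnP => yn.
      apply: (row s2 x (Ordinal yn)) => //.
        rewrite ss2.1 // touches_for touches_if orbF; apply/negP => /prune_row_touches //.
      by case: g2 => [g2|[-> yv]]; [left|right; split=> //; apply: val_inj].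
    by case: g2 => // -[_ yv]; move: yn; rewrite yv leqNgt ltn_ord.
  case: g1 => [g1|xu].
    apply: (@for_reach _ _ _ _ _ good L) => //; last by left.
    move=> y s2 yL yV ss2 [g2|yE]; first by apply: (step y) => //; left.
    by rewrite yE ltnn in yL.
  apply: (@for_reach _ _ _ _ _ good v) => //; last by right; apply: leq_trans leqnL.
  by move=> y s2 yL yV ss2 [g2|yv]; apply: (step y) => //; [left|right].
apply: (@for_reach _ _ _ _ _ good u) => //.
- rewrite touches_if touches_for orbF touches_if orbF /=; apply/negP => /prune_row_touches //.
- move=> x s1 xL xU ss1 g1; have [//|//|s1r s1X] := keep1 _ _ _ ss1 _ _ sr sX.
  rewrite exec_if /= xU; case: (s1r) => [_ -> _ _ _]; rewrite xL andbT.
  case: ltnP => xn; last by case: g1 => // xu; move: xn; rewrite xu leqNgt ltn_ord.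
  apply: (col s1 (Ordinal xn)) => //.
  by case: g1 => [g1|xu]; [left|right; apply: val_inj].
- by right; apply: leq_trans leqnL.
Qed.

Lemma copy_row_touches v : touches (seqs [seq copy_at i | i <- enum 'I_c]) v = false.
Proof. by rewrite touches_map (eq_has (a2 := pred0)) // has_pred0. Qed.

Lemma copy_row_writes a : writes (seqs [seq copy_at i | i <- enum 'I_c]) a ->
  exists i, a = Some (i, false).
Proof. by rewrite writes_map => /hasP[i _] /=; rewrite orbb => /eqP->; exists i. Qed.

Lemma round_touches v : touches round v -> scratch v || (v \in [:: vU; vV; vQ]).
Proof.
rewrite /round touches_seq [X in _ || X]touches_for copy_row_touches orbF.
case/orP => [/prune_all_touches|/eqP->//]; rewrite !inE.
by case/or3P => ->; rewrite ?orbT.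
Qed.

Lemma round_writes a : writes round a -> exists t, a = Some t.
Proof.
rewrite /round writes_seq [X in _ || X]writes_for => /orP[/prune_all_writes[i ->]|/copy_row_writes[i ->]];
  by eexists.
Qed.

Lemma round_busy : subpred (touches round) busy.
Proof.
move=> v /round_touches; rewrite /busy !inE => /or4P[] ->; rewrite ?orbT //.
Qed.

Lemma round_ready a b s : ready a b s -> ready a b (exec round s).
Proof.
by apply: ready_exec; [exact: round_busy|apply/negP => /round_writes[]].
Qed.

Lemma round_spec a b s X : ready a b s -> pruned_ok s X ->
  pruned_ok (exec round s) (prune e a b X).
Proof.
move=> sr sX i u v; rewrite /round exec_seq; set s1 := exec _ s.
have s1T := prune_all_spec i u v sr sX; rewrite -/s1 in s1T.
pose good (s' : st) := ar s' (Some (i, false)) (u * n + v) = ((i, u, v) \in prune e a b X).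
apply: (@for_reach _ _ _ _ _ good (u * n + v)) => //.
- by rewrite copy_row_touches.
- by rewrite /good => s2 s3 ->.
- move=> q s2 qL qQ ss2 g2.
  have step j s3 : same (touches (seqs [seq copy_at i | i <- enum 'I_c]))
      (writes (seqs [seq copy_at i | i <- enum 'I_c])) s2 s3 ->
      good s3 \/ j = i /\ q = u * n + v -> good (exec (copy_at j) s3).
    move=> ss3 g3; have s3Q : hd s3 vQ = q by rewrite ss3.1 // copy_row_touches.
    have s3T k : ar s3 (Some (k, true)) = ar s1 (Some (k, true)).
      rewrite ss3.2; last by apply/negP => /copy_row_writes[].
      by rewrite ss2.2 //; rewrite writes_for; apply/negP => /copy_row_writes[].
    rewrite /good /copy_at exec_if /= s3Q qL /= s3T.
    case E: (ar s1 _ _); rewrite exec_put /= /upd s3Q.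
      case: eqP => [[ij]|ne] /=; last by case: g3 => // -[ji]; case: ne; rewrite ji.
      have [qE|ne] := eqVneq (u * n + v) q; first by rewrite -s1T ij qE E ?eqxx.
      by case: g3 => [<-|[_ qE]]; [rewrite ij|rewrite qE eqxx in ne].
    case: eqP => [[ij]|ne] /=; last by case: g3 => // -[ji]; case: ne; rewrite ji.
    have [qE|ne] := eqVneq (u * n + v) q; first by rewrite -s1T ij qE E ?eqxx.
    by case: g3 => [<-|[_ qE]]; [rewrite ij|rewrite qE eqxx in ne].
  case: g2 => [g2|qE].
    by apply: (seqs_ind (I := fun _ => good)) => // j _ s3 _ ss3 g3; apply: step => //; left.
  apply: (@seqs_reach _ _ _ _ _ good i); last by right; rewrite mem_enum.
  by move=> j s3 _ ss3 [g3|ji]; apply: step => //; [left|right].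
- by right; apply: pos_lt.
Qed.

Lemma clear_row_writes a :
  writes (seqs [seq Put (Some (i, false)) vQ false | i <- enum 'I_c]) a -> exists t, a = Some t.
Proof. by rewrite writes_map => /hasP[i _ /eqP->]; eexists. Qed.

Lemma clear_touches v : touches clear v = (v == vQ).
Proof. by rewrite touches_for touches_map (eq_has (a2 := pred0)) // has_pred0 orbF. Qed.

Lemma clear_writes a : writes clear a -> exists t, a = Some t.
Proof. by rewrite writes_for; apply: clear_row_writes. Qed.

Lemma clear_spec s : pruned_ok (exec clear s) set0.
Proof.
move=> i u v; rewrite inE.
pose good (s' : st) := ar s' (Some (i, false)) (u * n + v) = false.
have rowt x : ~~ touches (seqs [seq Put (Some (i, false)) vQ false | i <- enum 'I_c]) x.
  by rewrite touches_map (eq_has (a2 := pred0)) // has_pred0.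
apply: (@for_reach _ _ _ _ _ good (u * n + v)) => //.
- by rewrite /good => s2 s3 ->.
- move=> q s2 qL qQ ss2 g2.
  have step j s3 : same (touches (seqs [seq Put (Some (i, false)) vQ false | i <- enum 'I_c]))
      (writes (seqs [seq Put (Some (i, false)) vQ false | i <- enum 'I_c])) s2 s3 ->
      good s3 \/ j = i /\ q = u * n + v -> good (exec (Put (Some (j, false)) vQ false) s3).
    move=> ss3 g3; have s3Q : hd s3 vQ = q by rewrite ss3.1.
    rewrite /good exec_put /= /upd s3Q; case: eqP => [[ij]|ne] /=.
      have [//|ne] := eqVneq (u * n + v) q.
      by case: g3 => [g3|[_ qE]]; [rewrite -ij|rewrite qE eqxx in ne].
    by case: g3 => // -[ji]; case: ne; rewrite ji.
  case: g2 => [g2|qE].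
    by apply: (seqs_ind (I := fun _ => good)) => // j _ s3 _ ss3 g3; apply: step => //; left.
  apply: (@seqs_reach _ _ _ _ _ good i); last by right; rewrite mem_enum.
  by move=> j s3 _ ss3 [g3|ji]; apply: step => //; [left|right].
- by right; apply: pos_lt.
Qed.

Let x0 : 'I_n := Ordinal n_gt0.

Lemma rounds_touches v : touches (seqs [seq Rep round | i <- enum 'I_c]) v ->
  scratch v || (v \in [:: vU; vV; vQ]).
Proof. by rewrite touches_map => /hasP[i _ /round_touches]. Qed.

Lemma trial_touches v : touches trial v -> busy v.
Proof.
rewrite /trial touches_seq clear_touches => /orP[/eqP->//|].
rewrite touches_seq => /orP[/rounds_touches|].
  by rewrite /busy !inE => /or4P[] ->; rewrite ?orbT.
rewrite touches_seq => /orP[/eqP->//|]; rewrite touches_seq => /orP[/eqP->//|].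
rewrite touches_seq => /orP[/= /or3P[/eqP->//|/orP[/eqP->|]//|/eqP->//]|].
by rewrite touches_seq => /orP[/feas_touches/scratch_busy//|/= /orP[/eqP->|]].
Qed.

Lemma trial_writes a : writes trial a -> exists t, a = Some t.
Proof.
rewrite /trial writes_seq => /orP[/clear_writes//|].
rewrite writes_seq => /orP[|]; first by rewrite writes_map => /hasP[i _ /round_writes].
do 3!rewrite writes_seq => /orP[//|].
by rewrite writes_seq feas_writes.
Qed.

Lemma rounds_spec a b s : ready a b s -> pruned_ok s set0 ->
  let s' := exec (seqs [seq Rep round | i <- enum 'I_c]) s in
  ready a b s' /\ pruned_ok s' (fixset (prune e a b)).
Proof.
move=> sr s0 s'.
suff: ready a b s' /\ pruned_ok s' (iter (size (enum 'I_c) * L) (prune e a b) set0).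
  by rewrite /fixset !card_prod !card_ord size_enum_ord mulnA.
apply: (seqs_ind (I := fun l s1 => ready a b s1 /\ pruned_ok s1 (iter (size l * L) (prune e a b) set0))) => //.
move=> j l s1 _ _ [s1r s1X]; rewrite size_rcons mulSn iterD.
rewrite -[exec (Rep round) s1]/(iter L (exec round) s1).
suff: forall m, ready a b (iter m (exec round) s1) /\
    pruned_ok (iter m (exec round) s1) (iter m (prune e a b) (iter (size l * L) (prune e a b) set0)).
  exact.
elim=> [//|m [IH1 IH2]]; rewrite !iterS; split; first exact: round_ready.
exact: round_spec.
Qed.

Lemma trial_spec a b s : ready a b s ->
  (0 < hd (exec trial s) vR) =
  (0 < hd s vR) || feasible e a b x0 (unpruned (fixset (prune e a b)) x0).
Proof.
move=> sr; rewrite /trial exec_seq; set s1 := exec clear s.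
have s1r : ready a b s1.
  apply: ready_exec sr => [v|]; first by rewrite clear_touches => /eqP->.
  by apply/negP => /clear_writes[].
rewrite exec_seq; set s2 := exec (seqs _) s1.
have [s2r s2X] : ready a b s2 /\ pruned_ok s2 (fixset (prune e a b)).
  by apply: rounds_spec => //; apply: clear_spec.
have s2R : hd s2 vR = hd s vR.
  by rewrite /s2 frame_hd ?/s1 ?frame_hd ?clear_touches //; apply/negP => /rounds_touches.
rewrite exec_seq exec_zero; set s3 := St _ _.
rewrite exec_seq exec_zero; set s4 := St _ _.
rewrite exec_seq; set s5 := exec _ s4.
have s3r : ready a b s3 by apply: (@ready_exec (Zero vU)) s2r => // v /eqP->.
have s4r : ready a b s4 by apply: (@ready_exec (Zero vV)) s3r => // v /eqP->.
have s5r : ready a b s5.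
  apply: ready_exec s4r => // v; rewrite touches_for touches_if /= orbF.
  by case/orP => /eqP->.
have s5V : hd s5 vV = n.
  by rewrite /s5 add_to_spec // (_ : hd s4 vV = 0) //; case: s4r => _ -> _ _ _; rewrite (minn_idPr leqnL).
have s5U : hd s5 vU = x0 by rewrite /s5 frame_hd.
have s5R : hd s5 vR = hd s vR by rewrite /s5 frame_hd // -s2R.
have s5X : pruned_ok s5 (fixset (prune e a b)) by move=> i u v; rewrite /s5 frame_ar // -s2X.
have L0 : 0 < L by rewrite muln_gt0 n_gt0.
rewrite exec_seq; set s6 := exec _ s5.
have s6r : ready a b s6.
  apply: ready_exec s5r => [v /feas_touches/scratch_busy//|]; by rewrite feas_writes.
have s6R : hd s6 vR = hd s vR.
  by rewrite /s6 frame_hd //; apply/negP => /feas_touches.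
have s6F : (0 < hd s6 vF) = feasible e a b x0 (unpruned (fixset (prune e a b)) x0).
  case: (s5r) => [sZ sN sa sA sB].
  rewrite /s6 (@feas_spec _ _ (fixset (prune e a b)) x0) //; last first.
  - by move=> j; case: (sB j) => ->.
  - by move=> j; case: (sA j) => ->.
  have -> : (fun j => hd s5 (vA j)) = a by apply/funext => j; case: (sA j).
  have -> : (fun j => hd s5 (vB j)) = b by apply/funext => j; case: (sB j).
  (* [vV] holds [n], so no vertex [w] is pinned and the lists are those of [unpruned]. *)
  congr feasible; apply/funext => w.
  by rewrite /counted s5V ltn_eqF.
rewrite exec_if /=; case: (s6r) => [-> _ _ _ _]; rewrite L0 andbT s6F.
by case: feasible; rewrite execE /= ?s6R ?orbT ?orbF.
Qed.

Lemma bound_vars_busy v : v \in bound_vars -> ~~ busy v.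
Proof. by rewrite mem_cat => /orP[] /mapP[j _ ->]. Qed.

Lemma scalar_bound k (kP : k < 14) : @scalar k kP \notin bound_vars.
Proof. by rewrite mem_cat; apply/norP; split; apply/mapP => -[]. Qed.

Lemma decide_spec s : adj_ok s ->
  let s' := exec decide s in
  holds L (hd s') (ar s') (Lt vZ vR) <->
  exists a b : 'I_c -> nat, [/\ forall i, a i < L, forall i, b i < L &
    feasible e a b x0 (unpruned (fixset (prune e a b)) x0)].
Proof.
move=> sa; rewrite /decide exec_seq exec_zero; set s1 := St _ _.
rewrite exec_seq; set s2 := exec _ s1; rewrite exec_seq exec_zero; set s3 := St _ _.
have L0 : 0 < L by rewrite muln_gt0 n_gt0.
have s3N : hd s3 vN = n by rewrite /s3 /= /upd /= find_n_spec.
have s3Z : hd s3 vZ = 0 by rewrite /s3 /= /upd /= /s2 frame_hd.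
have s3a : adj_ok s3 by move=> u v; rewrite /s3 /= /s2 frame_ar // -sa.
set s' := exec _ s3.
have Z' : hd s' vZ = 0.
  by rewrite /s' frame_hd // touches_loops; apply/norP; split;
    [exact: scalar_bound|apply/negP => /trial_touches].
rewrite [holds _ _ _ _]/= Z' L0 andbT.
pose g (h : var -> nat) := let a j := h (vA j) in let b j := h (vB j) in
  feasible e a b x0 (unpruned (fixset (prune e a b)) x0).
have [||||s4 ss4 s4L|H1 H2] := @loops_exists _ _ L bound_vars trial vR g s3.
- rewrite cat_uniq; apply/and3P; split; try by rewrite map_inj_uniq ?enum_uniq // => i j [].
  by apply/hasPn => v /mapP[j _ ->]; apply/mapP => -[].
- by apply/allP => v /bound_vars_busy; apply: contra; apply: trial_touches.
- by apply/negP => /bound_vars_busy.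
- move=> h h' hh; rewrite /g.
  have -> : (fun j => h (vA j)) = (fun j => h' (vA j)).
    by apply/funext => j; apply: hh; rewrite mem_cat map_f ?mem_enum.
  have -> // : (fun j => h (vB j)) = (fun j => h' (vB j)).
  by apply/funext => j; apply: hh; rewrite mem_cat orbC map_f ?mem_enum.
- apply: trial_spec; split.
  + by rewrite ss4.1 // touches_loops; apply/norP; split;
      [exact: scalar_bound|apply/negP => /trial_touches].
  + by rewrite ss4.1 // touches_loops; apply/norP; split;
      [exact: scalar_bound|apply/negP => /trial_touches].
  + by move=> u v; rewrite ss4.2 //; apply/negP => /trial_writes[].
  + by move=> j; split=> //; apply: s4L; rewrite mem_cat map_f ?mem_enum.
  + by move=> j; split=> //; apply: s4L; rewrite mem_cat orbC map_f ?mem_enum.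
split=> [/H1[|[h hL gh]]|[a [b [aL bL f]]]].
- by rewrite /s3 /= /upd.
- exists (fun j => h (vA j)), (fun j => h (vB j)); split=> // j; apply: hL.
    by rewrite mem_cat map_f ?mem_enum.
  by rewrite mem_cat orbC map_f ?mem_enum.
apply: H2; right.
exists (fun v => match v with inl (inr (inl j)) => a j | inl (inr (inr j)) => b j | _ => 0 end) => //.
by move=> v; rewrite mem_cat => /orP[] /mapP[j _ ->]; [apply: aL|apply: bL].
Qed.

End Correctness.
End Program.

(** * The input encoding and the conclusion *)

Definition adjacency n (e : rel 'I_n) : seq bool := [seq e i j | i <- enum 'I_n, j <- enum 'I_n].

Lemma encode_adjacency n (e : rel 'I_n) : encode e = map sym_of_bool (adjacency e).
Proof. by rewrite /adjacency map_allpairs. Qed.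

Lemma size_adjacency n (e : rel 'I_n) : size (adjacency e) = n * n.
Proof. by rewrite size_allpairs size_enum_ord. Qed.

Lemma nth_adjacency n (e : rel 'I_n) (u v : 'I_n) : nth false (adjacency e) (u * n + v) = e u v.
Proof.
pose ss := [seq [seq e i j | j <- enum 'I_n] | i <- enum 'I_n].
have sh : shape ss = nseq n n.
  have/all_pred1P: all (pred1 n) (shape ss).
    by rewrite /shape -map_comp all_map; apply/allP => i _; rewrite /= size_map size_enum_ord.
  by move=> {1}->; rewrite /shape size_map /ss size_map size_enum_ord.
have uv : u * n + v = flatten_index (shape ss) u v.
  by rewrite /flatten_index sh take_nseq ?sumn_nseq 1?mulnC // ltnW.
have vn : v < nth 0 (shape ss) u by rewrite sh nth_nseq ltn_ord.
rewrite /adjacency -/ss uv nth_flatten flatten_indexKl // flatten_indexKr //.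
rewrite (nth_map u) ?size_enum_ord // (nth_map v) ?size_enum_ord //.
by rewrite !nth_ord_enum.
Qed.

Theorem theorem1 (c : nat) (hc : 0 < c) :
  exists (M : TM) (k a : nat),
    forall (n : nat) (e : rel 'I_n), is_tree e ->
      run (a * (size (encode e)).+1 ^ k) (init_config M (encode e))
      = Some (wr e <= c).
Proof.
pose i0 := Ordinal hc.
have [M [k [a run_M]]] := program_polytime (None : arr c) (decide i0) (Lt (vZ c) (vR c)).
exists M, k, a => n e [simp n_gt0 conn card_e].
have [e_sym e_irr] := simp.
rewrite encode_adjacency size_map run_M size_adjacency ?muln_gt0 ?n_gt0 //.
congr Some; set s := initial _ _ _.
have s_adj : adj_ok e s by move=> u v; rewrite /s /= nth_adjacency.
have nL : n <= n * n by rewrite leq_pmull.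
have [D1 D2] := decide_spec i0 n_gt0 e_irr e_sym s_adj.
(* The program searches bounds up to the tape length [n * n] rather than [n]; [wr_good] permits
   every range from [n] on. *)
have [W1 W2] := wr_good simp hc n_gt0 nL.
apply/idP/idP => [/D1[a1 [b1 [aL bL f]]]|/W1[a1 [b1 [aL bL f]]]].
  apply: W2; exists a1, b1; split=> //.
  exact: (good_iff_feasible e_sym e_irr conn card_e a1 b1 _).2 f.
apply: D2; exists a1, b1; split=> //.
exact: (good_iff_feasible e_sym e_irr conn card_e a1 b1 _).1 f.
Qed.
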